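(* For each real $B>0$ there is a real number $c$ (depending only on $B$) with the following property. Let $D\ge 2$ be an integer, let $\chi$ be a Dirichlet character modulo $D$, let $\delta$ be a real number with $8D^{-3B}\le\delta\le 1$, let $t$ be a real number with $|t|\le D^B$, let $x$ be a real number, and put $L=\sum_{D<p\le x}p^{-1}$. Let $S$ be a set of primes $p$ in the interval $(D,x]$ for which $$\sum_{p\in S}p^{-1}\left|1-\chi(p)p^{it}\right|^2\le \delta L.$$ Then either $$\sum_{p\in S}p^{-1}\le 4\delta^{1/3}L+c,$$ or the order of $\chi$ is less than $2\delta^{-1/3}$.
   Context: The letter $p$ denotes a prime number; $\sum_{D<p\le x}$ is a sum over primes $p$ in the interval $(D,x]$. The order of a Dirichlet character $\chi$ modulo $D$ is its order as an element of the group of Dirichlet characters modulo $D$, i.e. the least positive integer $r$ for which $\chi^r$ is the principal character modulo $D$. *)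

(* Defs.v *)
From HB Require Import structures.
From mathcomp Require Import all_boot all_order all_algebra.
From mathcomp Require Import all_classical all_reals all_analysis.
From mathcomp Require Import complex.

Set Implicit Arguments.
Unset Strict Implicit.
Unset Printing Implicit Defensive.

Import Order.TTheory GRing.Theory Num.Theory.

Local Open Scope classical_set_scope.
Local Open Scope ring_scope.

(* The condition [chi 1 = 1] follows from [dchar_supp] and [dchar_mul]. *)
Record is_dirichlet_character (R : realType) (D : nat) (chi : int -> R[i]) :
    Prop := IsDirichletCharacter {
  dchar_mul : forall m n : int, chi (m * n) = chi m * chi n;
  dchar_periodic : forall n : int, chi (n + D%:Z) = chi n;
  dchar_supp : forall n : int, chi n != 0 <-> coprimez n D%:Z }.

Definition principal_character (R : realType) (D : nat) : int -> R[i] :=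
  fun n => (coprimez n D%:Z)%:R.

Definition dchar_exp (R : realType) (chi : int -> R[i]) (r : nat) :
    int -> R[i] :=
  fun n => chi n ^+ r.

(* [r] is the order of [chi] in the group of Dirichlet characters modulo [D];
   a relation rather than a function, so that no default value is needed. *)
Definition is_dchar_order (R : realType) (D : nat) (chi : int -> R[i])
    (r : nat) : Prop :=
  [/\ (0 < r)%N,
      dchar_exp chi r = principal_character R D &
      forall k : nat, (0 < k)%N ->
        dchar_exp chi k = principal_character R D -> (r <= k)%N].

(* [n ^ (i t) = exp (i t log n)], for [0 < n]. *)
Definition natpow_it (R : realType) (n : nat) (t : R) : R[i] :=
  (cos (t * ln n%:R) +i* sin (t * ln n%:R))%C.

Definition primes_between (R : realType) (D : nat) (x : R) : set nat :=
  [set p : nat | [/\ prime p, (D < p)%N & p%:R <= x]].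

(* Main.v *)
Require Import Defs.
From HB Require Import structures.
From mathcomp Require Import all_boot all_order all_algebra all_solvable.
From mathcomp Require Import all_classical all_reals all_analysis.
From mathcomp Require Import complex.
From mathcomp Require Import ring lra zify.
From mathcomp Require Import unstable.
From mathcomp Require Import fintype finset.

Set Implicit Arguments.
Unset Strict Implicit.
Unset Printing Implicit Defensive.

Import Order.TTheory GRing.Theory Num.Theory.
Import numFieldNormedType.Exports.

Local Open Scope ring_scope.

(** Write [eta = delta ^ (1/3)] and let the order [r] of [chi] be at least
    [2 / eta]; the claim is then the upper bound for the sum over [S].

    Far primes.  If [|1 - chi(p) p^(it)| > (15/16) eta], the hypothesis weighs
    [1/p] by more than [(15/16)^2 eta^2], so such [p] contribute at most
    [(256/225) eta L].

    Near primes.  Let [U] be a power of [D] which is large compared with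
    [|t| / eta]; since [eta >= 2 D^(-B)], a fixed power of [D] will do.  Cut
    the integers from [D^O(1)] on into blocks [[y, y + D 32^i)] with
    [y = D 32^i u] and [U <= u < 32 U].  On a block [p^(it)] is constant up to
    [eta/16], so [chi(p)] lies on an arc: [|chi(p) y^(it) - 1| <= eta].
    - At most [(27/32) eta phi(D)] residue classes put [chi] on that arc
      ([dchar_arc_count]).  This is where the order matters: the sum over the
      classes of [|sum_(k < N) (chi(a) w)^k|^2] is only the diagonal
      [N phi(D)] as long as [N <= r], while on the arc each summand has size
      about [N^2].
    - Each class contains, in the block, at most
      [32^i D / (phi(D) ln 4^i) + 16^i] primes: Selberg's sieve by the primes
      up to [4^i] ([brun_titchmarsh_progression]).
    Summing over [u], the blocks of scale [i] contribute at most
    [eta (11/5 / i + 5 / 2^i)] ([scale_bound]).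

    Comparison with [L].  Mertens' theorem and partial summation give
    [sum 1/i <= sum 1/p + O(1)], the primes running over the same powers of
    [32] ([harmonic_le_primes]); so the near primes beyond [D^O(1)] contribute
    at most [(11/5) eta L + O(1)].  Those between [D] and [D^O(1)] have total
    reciprocal [O(1)], again by Mertens ([short_range_sum_le]).  Finally
    [256/225 + 11/5 < 4].

    The slack in the last inequality is what allows an upper bound sieve, which
    overcounts by a constant factor, to replace information on the zeros of
    L-functions. *)

(** * Sums over the subsets of a finite set *)

Lemma sum_prod_subset (R : comNzRingType) (T : finType) (f : T -> R)
    (C : {set T}) :
  \sum_(E : {set T} | E \subset C) \prod_(q in E) f q
    = \prod_(q in C) (1 + f q).
Proof.
rewrite big_mkcond [RHS]big_mkcond /=.
have -> : \prod_q (if q \in C then 1 + f q else 1) =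
          \prod_q ((if q \in C then f q else 0) + 1).
  by apply: eq_bigr => q _; case: ifP => _; rewrite ?add0r // addrC.
rewrite bigA_distr; apply: eq_big => // E _; case: ifP => [sEC | /negbT].
  rewrite big_mkcond; apply: eq_bigr => q _; case: ifP => // qE.
  by rewrite (subsetP sEC).
case/subsetPn => q qE qC; rewrite (bigD1 q) //= qE (negPf qC) mul0r //.
Qed.

Lemma sum_sign_between (R : comNzRingType) (T : finType) (E F : {set T}) :
  E \subset F ->
  \sum_(A : {set T} | (E \subset A) && (A \subset F)) (-1) ^+ #|A|
    = (E == F)%:R * (-1) ^+ #|E| :> R.
Proof.
move=> sEF.
have sgn (A : {set T}) : (-1) ^+ #|A| = \prod_(q in A) (-1 : R).
  by rewrite prodr_const.
(* The factor is [-1] on [E], [-1 + 1] on [F :\: E] and [1] outside [F]. *)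
have -> : \sum_(A : {set T} | (E \subset A) && (A \subset F)) (-1) ^+ #|A|
    = \prod_q ((if q \in F then -1 else 0) + (if q \in E then 0 else 1)) :> R.
  rewrite bigA_distr big_mkcond; apply: eq_bigr => A _.
  case: ifP => [/andP[sEA sAF] | /negbT]; last first.
    rewrite negb_and; case/orP => /subsetPn[q q1 q2].
      by rewrite (bigD1 q) //= (negPf q2) q1 mul0r.
    by rewrite (bigD1 q) //= q1 (negPf q2) mul0r.
  rewrite sgn big_mkcond; apply: eq_bigr => q _; case: ifP => [qA|/negbT qA].
    by rewrite (subsetP sAF).
  by rewrite (negPf (contra (subsetP sEA q) qA)).
case: (eqVneq E F) => [<-|nEF].
  rewrite mul1r sgn [RHS]big_mkcond; apply: eq_bigr => q _.
  by case: ifP => _; rewrite ?addr0 ?add0r.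
have /properP[_ [q qF qE]] : E \proper F by rewrite properEneq nEF.
by rewrite (bigD1 q) //= qF (negPf qE) addNr !mul0r.
Qed.

(** * The quadratic form of the Selberg sieve *)

Section Selberg.
Variables (R : realFieldType) (T : finType) (p : T -> R) (V : pred {set T}).
Hypothesis p_gt1 : forall q, 1 < p q.

(** A squarefree number is represented by its set of prime factors [A], with
    [p] giving the primes: [setprod A] is the number, [setphi A] its totient,
    and union and intersection are lcm and gcd. *)
Definition setprod (A : {set T}) : R := \prod_(q in A) p q.
Definition setphi (A : {set T}) : R := \prod_(q in A) (p q - 1).
Definition selberg_G : R := \sum_(E | V E) (setphi E)^-1.
(** Selberg's choice of the sieve weights for the numbers in [V], normalized to be
    [1] at the number [1]. *)
Definition selberg_lambda (A : {set T}) : R :=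
  (-1) ^+ #|A| * setprod A / selberg_G
    * \sum_(E : {set T} | V E && (A \subset E)) (setphi E)^-1.

Lemma setprod_gt0 A : 0 < setprod A.
Proof. by apply: prodr_gt0 => q _; rewrite (lt_trans ltr01). Qed.

Lemma setphi_gt0 A : 0 < setphi A.
Proof. by apply: prodr_gt0 => q _; rewrite subr_gt0. Qed.

Lemma setprodUI A B : setprod (A :|: B) * setprod (A :&: B)
  = setprod A * setprod B.
Proof.
rewrite /setprod [\prod_(i in A :|: B) _](big_setID A) /= setUK.
rewrite setDUl setDv set0U [\prod_(i in B) p i](big_setID A) /= setIC.
by rewrite -mulrA [X in _ * X = _]mulrC.
Qed.

Lemma setprod_sum_setphi C : setprod C = \sum_(E : {set T} | E \subset C) setphi E.
Proof.
rewrite /setprod /setphi sum_prod_subset; apply: eq_bigr => q _.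
by rewrite addrC subrK.
Qed.

Hypothesis V0 : V set0.

Lemma selberg_G_gt0 : 0 < selberg_G.
Proof.
rewrite /selberg_G (bigD1 set0) //= ltr_pwDl ?invr_gt0 ?setphi_gt0 //.
by apply: sumr_ge0 => E _; rewrite invr_ge0 ltW ?setphi_gt0.
Qed.

Lemma selberg_lambda0 : selberg_lambda set0 = 1.
Proof.
rewrite /selberg_lambda cards0 expr0 mul1r /setprod big_set0 mul1r.
rewrite (eq_bigl V) ?mulVf ?gt_eqF ?selberg_G_gt0 // => E.
by rewrite sub0set andbT.
Qed.

(** The change of variables that diagonalizes the quadratic form: the new
    variable at [E] is a double sum over [E <= A <= F], in which the signs
    cancel unless [F = E]. *)
Lemma selberg_lambda_inversion (E : {set T}) :
  \sum_(A : {set T} | E \subset A) selberg_lambda A / setprod A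
    = (V E)%:R * (-1) ^+ #|E| / setphi E / selberg_G.
Proof.
transitivity (\sum_(F | V F) (setphi F)^-1 / selberg_G *
    \sum_(A : {set T} | (E \subset A) && (A \subset F)) (-1) ^+ #|A|).
  under [RHS]eq_bigr do rewrite mulr_sumr.
  rewrite (exchange_big_dep (fun A : {set T} => E \subset A)) /=; last first.
    by move=> F A _ /andP[].
  apply: eq_bigr => A sEA.
  rewrite /selberg_lambda mulr_sumr mulr_suml.
  rewrite sEA /=.
  apply: eq_bigr => F _.
  have := setprod_gt0 A; have := setphi_gt0 F; have := selberg_G_gt0.
  by move=> /gt_eqF h1 /gt_eqF h2 /gt_eqF h3; field; rewrite h1 h2 h3.
rewrite (bigID (fun F : {set T} => E \subset F)) /= [X in _ + X]big1; last first.
  move=> F /andP[_ nEF]; rewrite big1 ?mulr0 // => A /andP[sEA sAF].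
  by case/negP: nEF; apply: subset_trans sEA sAF.
rewrite addr0; under eq_bigr => F /andP[_ sEF] do rewrite sum_sign_between //.
case VE: (V E); last first.
  rewrite big1 ?mul0r // => F /andP[VF _].
  by case: eqP => [eEF|]; [rewrite eEF VF in VE | rewrite mul0r mulr0].
rewrite (bigD1 E) ?VE ?subxx //= eqxx big1 ?addr0; last first.
  by move=> F /andP[_]; rewrite eq_sym => /negPf->; rewrite mul0r mulr0.
by rewrite !mul1r; ring.
Qed.

(** Since [1 / lcm = gcd / product] and [gcd] is the sum of [phi] over the
    common divisors, the form is [sum_E phi(E) y_E^2] in the variables [y_E] of
    [selberg_lambda_inversion]. *)
Lemma selberg_quadratic_form :
  \sum_A \sum_B selberg_lambda A * selberg_lambda B / setprod (A :|: B)
    = selberg_G^-1.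
Proof.
transitivity (\sum_(E : {set T}) setphi E *
    (\sum_(A : {set T} | E \subset A) selberg_lambda A / setprod A) ^+ 2).
  transitivity (\sum_(A : {set T}) \sum_(B : {set T}) \sum_(E : {set T})
    if (E \subset A) && (E \subset B) then
      setphi E * ((selberg_lambda A / setprod A)
                  * (selberg_lambda B / setprod B)) else 0).
    apply: eq_bigr => A _; apply: eq_bigr => B _.
    rewrite -big_mkcond /= -mulr_suml.
    under eq_bigl do rewrite -subsetI.
    rewrite -setprod_sum_setphi.
    have := setprodUI A B.
    move: (setprod_gt0 A) (setprod_gt0 B) (setprod_gt0 (A :|: B)).
    move=> /gt_eqF h1 /gt_eqF h2 /gt_eqF h3 h.
    have -> : (setprod (A :&: B)) = setprod A * setprod B / setprod (A :|: B).
      by rewrite -h; field; rewrite h3.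
    by field; rewrite h1 h2 h3.
  under eq_bigr do rewrite exchange_big /=.
  rewrite exchange_big /=; apply: eq_bigr => E _.
  rewrite expr2 mulr_suml mulr_sumr [RHS]big_mkcond; apply: eq_bigr => A _.
  case: ifP => sEA /=; last by rewrite big1.
  rewrite mulr_sumr mulr_sumr [RHS]big_mkcond; apply: eq_bigr => B _.
  by case: ifP.
have Gn0 := gt_eqF selberg_G_gt0.
transitivity (\sum_(E | V E) (setphi E)^-1 / selberg_G ^+ 2).
  rewrite [RHS]big_mkcond; apply: eq_bigr => E _.
  rewrite selberg_lambda_inversion; case: (V E); last by rewrite !mul0r expr0n mulr0.
  have hE := gt_eqF (setphi_gt0 E); rewrite mul1r !exprMn.
  by rewrite sqrr_sign mul1r; field; rewrite hE Gn0.
by rewrite -mulr_suml -/selberg_G; field; rewrite Gn0.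
Qed.

End Selberg.

(** * Size of the sieve weights and of the main term *)

Section SelbergBounds.
Variables (R : realFieldType) (T : finType) (p : T -> R).
Hypothesis p_gt1 : forall q, 1 < p q.
Implicit Types (A E F P l : {set T}) (y : R).

Lemma setIU_split l F A : l \subset A -> F \subset ~: A ->
  (l :|: F) :&: A = l /\ (l :|: F) :\: A = F.
Proof.
move=> slA sFA; have FA : F :&: A = set0.
  by apply/eqP; rewrite setI_eq0 disjoints_subset.
have /eqP lA : l :\: A == set0 by rewrite setD_eq0.
rewrite setIUl setDUl FA lA (setIidPl slA) setU0 set0U (setDidPl _) //.
by rewrite -setI_eq0 FA.
Qed.

Lemma sum_set_split (A : {set T}) (f : {set T} -> R) :
  \sum_(E : {set T}) f E = \sum_(l : {set T} | l \subset A)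
                             \sum_(F : {set T} | F \subset ~: A) f (l :|: F).
Proof.
rewrite pair_big_dep /=.
rewrite (reindex_onto (fun u : {set T} * {set T} => u.1 :|: u.2)
           (fun E => (E :&: A, E :\: A))) /=; last first.
  by move=> E _; rewrite setID.
apply: eq_bigl => -[l F] /=.
apply/eqP/andP => [[hl hF] | [slA sFA]].
  by split; [rewrite -hl subsetIr | rewrite -hF setDE subsetIr].
by case: (setIU_split slA sFA) => -> ->.
Qed.

Lemma prod_setU_split l F A (f : T -> R) : l \subset A -> F \subset ~: A ->
  \prod_(q in l :|: F) f q = \prod_(q in l) f q * \prod_(q in F) f q.
Proof.
by move=> slA sFA; rewrite (big_setID A) /=; case: (setIU_split slA sFA) => -> ->.
Qed.

Definition selberg_support P y : pred {set T} :=
  fun E => (E \subset P) && (setprod p E <= y).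

Lemma setprodU l F A : l \subset A -> F \subset ~: A ->
  setprod p (l :|: F) = setprod p l * setprod p F.
Proof. exact: prod_setU_split. Qed.

Lemma setphiU l F A : l \subset A -> F \subset ~: A ->
  setphi p (l :|: F) = setphi p l * setphi p F.
Proof. exact: prod_setU_split. Qed.

Lemma setprod_ge1 A : 1 <= setprod p A.
Proof.
rewrite /setprod; elim/big_rec: _ => // q x _ x1.
by rewrite (le_trans x1) // ler_peMl ?(le_trans ler01) // ltW.
Qed.

Lemma sum_setphi_inv A :
  \sum_(l : {set T} | l \subset A) (setphi p l)^-1
    = setprod p A / setphi p A.
Proof.
rewrite /setphi; rewrite (eq_bigr (fun l : {set T} => \prod_(q in l) (p q - 1)^-1)); last first.
  by move=> l _; rewrite prodfV.
rewrite sum_prod_subset /setprod -prodf_div; apply: eq_bigr => q _.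
have : p q - 1 != 0 by rewrite subr_eq0 gt_eqF.
by move=> h; field.
Qed.

(** Splitting each set into its parts inside and outside [A] shows that
    discarding the primes of [A] costs at most the factor [A / phi A]. *)
Lemma selberg_G_discard P A y :
  selberg_G p (selberg_support P y) <=
    setprod p A / setphi p A * selberg_G p (selberg_support (P :\: A) y).
Proof.
rewrite /selberg_G big_mkcond /= (sum_set_split A) -sum_setphi_inv mulr_suml.
apply: ler_sum => l slA; rewrite mulr_sumr [leRHS]big_mkcond.
rewrite [leLHS]big_mkcond; apply: ler_sum => F _ /=; case: ifP => sFA.
  case: ifP => [|_]; last first.
    by case: ifP => // _; rewrite mulr_ge0 ?invr_ge0 ?ltW ?setphi_gt0.
  rewrite /selberg_support subUset => /andP[/andP[_ sFP]].
  rewrite (setprodU slA sFA) (setphiU slA sFA) => hy.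
  rewrite ifT ?invfM // setDE subsetI sFP sFA /= (le_trans _ hy) //.
  by rewrite ler_peMl ?setprod_ge1 // ltW ?setprod_gt0.
by case: ifP => // _; rewrite mulr_ge0 ?invr_ge0 ?ltW ?setphi_gt0.
Qed.

(** After splitting [E] by [A], the weight at [A] is a sum over the sets
    [A :|: F]; replacing [A] by its subsets [l], whose [1 / phi] add up to
    [A / phi A], only weakens the size condition, and produces [selberg_G]. *)
Lemma selberg_lambda_le1 P A y : 1 <= y ->
  `|selberg_lambda p (selberg_support P y) A| <= 1.
Proof.
move=> y1; set V := selberg_support P y.
have V0 : V set0.
  by rewrite /V /selberg_support sub0set /setprod big_set0.
have G0 := selberg_G_gt0 p_gt1 V0.
rewrite /selberg_lambda normrM !normrM normrX normrN1 expr1n mul1r.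
rewrite (gtr0_norm (setprod_gt0 p_gt1 _)) gtr0_norm ?invr_gt0 //.
rewrite ger0_norm; last first.
  by apply: sumr_ge0 => E _; rewrite invr_ge0 ltW ?setphi_gt0.
rewrite mulrAC ler_pdivrMr // mul1r /selberg_G.
rewrite [X in X <= _](_ : _ =
    \sum_(l : {set T} | l \subset A) \sum_(F : {set T} | F \subset ~: A)
      if V (A :|: F) then (setphi p l)^-1 / setphi p F else 0).
  rewrite [leRHS]big_mkcond /= (sum_set_split A).
  apply: ler_sum => l slA; apply: ler_sum => F sFA.
  case: ifP => [|_]; last by case: ifP => // _; rewrite invr_ge0 ltW ?setphi_gt0.
  rewrite /V /selberg_support subUset => /andP[/andP[sAP sFP]].
  rewrite (setprodU (subxx A) sFA) => hy; rewrite ifT.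
    by rewrite (setphiU slA sFA) invfM.
  rewrite subUset (subset_trans slA) // sFP (setprodU slA sFA) /=.
  rewrite (le_trans _ hy) // ler_pM2r ?setprod_gt0 // /setprod.
  rewrite [leRHS](big_setID l) /= (setIidPr slA) ler_peMr ?setprod_ge1 //.
  by rewrite ltW ?setprod_gt0.
under [RHS]eq_bigr do rewrite -big_mkcondr -mulr_sumr.
rewrite -mulr_suml sum_setphi_inv -mulrA; congr (_ * _).
rewrite big_mkcond /= (sum_set_split A) (bigD1 A) //= [X in _ + X]big1 ?addr0.
  rewrite mulr_sumr [RHS]big_mkcondr; apply: eq_bigr => F sFA.
  by rewrite subsetUl andbT (setphiU (subxx A) sFA) invfM.
move=> l /andP[slA nlA]; rewrite big1 // => F sFA; rewrite ifF //.
apply/negP => /andP[_ sA]; case/negP: nlA; rewrite eqEsubset slA /=.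
apply/subsetP => q qA; move/subsetP: sA => /(_ q qA); rewrite inE.
by case/orP => // /(subsetP sFA); rewrite inE qA.
Qed.
End SelbergBounds.

(** * Squarefree numbers as sets of primes *)

Lemma sum_multiples (R : nmodType) (f : nat -> R) (q N : nat) : (0 < q)%N ->
  \sum_(1 <= n < N.+1 | (q %| n)%N) f n
    = \sum_(1 <= m < (N %/ q).+1) f (q * m)%N.
Proof.
move=> q0; rewrite -big_filter -[RHS](big_map (muln q) predT f).
apply: perm_big; apply: uniq_perm.
- by rewrite filter_uniq ?iota_uniq.
- by rewrite map_inj_uniq ?iota_uniq // => a b /eqP; rewrite eqn_pmul2l // => /eqP.
move=> n; rewrite mem_filter mem_index_iota; apply/idP/mapP.
  case/and3P => /dvdnP[m ->]; rewrite mulnC muln_gt0 => /andP[_ m0] hm.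
  exists m => //; rewrite mem_index_iota m0 ltnS leq_divRL // mulnC.
  by rewrite -ltnS.
case=> m; rewrite mem_index_iota ltnS leq_divRL // => /andP[m0 hm] ->.
by rewrite dvdn_mulr // muln_gt0 q0 m0 ltnS mulnC.
Qed.

Section PrimeSets.
Variables (R : realFieldType) (z : nat).
Implicit Types (A E : {set 'I_z.+1}).

(** The bound [2] only matters at the two non-primes [0] and [1], where it
    keeps the weight above [1]. *)
Definition prime_weight (q : 'I_z.+1) : R := (maxn 2 q)%:R.
Definition primes_upto : {set 'I_z.+1} := [set q : 'I_z.+1 | prime q].
Definition prime_support (n : nat) : {set 'I_z.+1} :=
  [set q : 'I_z.+1 | (q : nat) \in primes n].

Lemma prime_weight_gt1 q : 1 < prime_weight q.
Proof. by rewrite /prime_weight ltr1n leq_max. Qed.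

Lemma prime_weightE (q : 'I_z.+1) : prime q -> prime_weight q = q%:R.
Proof. by move=> /prime_gt1 q1; rewrite /prime_weight (maxn_idPr q1). Qed.

Lemma setprod_primesE A : A \subset primes_upto ->
  setprod prime_weight A = (\prod_(q in A) (q : nat))%:R.
Proof.
move=> sA; rewrite natr_prod; apply: eq_bigr => q qA; apply: prime_weightE.
by have := subsetP sA q qA; rewrite inE.
Qed.

Lemma prod_primes_dvd A n : A \subset primes_upto ->
  (\prod_(q in A) (q : nat) %| n)%N = (A \subset [set q : 'I_z.+1 | (q %| n)%N]).
Proof.
move=> /subsetP sA; have pA q : q \in A -> prime q by move=> /sA; rewrite inE.
apply/Gauss_dvd_prod/subsetP => [|h q qA|h q _ qA].
- rewrite pairwise_map; set s := [seq _ <- _ | _].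
  have := uniq_pairwise s; rewrite filter_uniq ?index_enum_uniq // => /esym.
  apply: (@sub_in_pairwise _ (mem A)); last by rewrite filter_all.
  move=> q r qA rA /=; rewrite -val_eqE /= => nqr.
  by rewrite prime_coprime ?pA // dvdn_prime2 ?pA.
- by rewrite inE h // mem_index_enum.
- by have := h q qA; rewrite inE.
Qed.

Lemma prime_support_sub n : prime_support n \subset primes_upto.
Proof. by apply/subsetP => q; rewrite !inE mem_primes => /andP[]. Qed.

(** The full series over the integers with prime factors exactly [E] is a
    product of geometric series with value [1 / phi E].  For a truncated sum,
    induct on [N]: fix [q] in [E] and divide by [q], which leaves an integer
    whose prime factors are [E] or [E :\ q]. *)
Lemma sum_inv_prime_support N E : (N <= z)%N ->
  \sum_(1 <= n < N.+1 | prime_support n == E) (n%:R^-1 : R)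
     <= (setphi prime_weight E)^-1.
Proof.
elim/ltn_ind: N E => N IH E Nz.
case: (set_0Vmem E) => [->|[q qE]].
  rewrite /setphi big_set0 invr1.
  apply: (@le_trans _ _ (\sum_(1 <= n < N.+1 | n == 1%N) (n%:R^-1 : R))).
    rewrite big_nat_cond [leRHS]big_nat_cond.
    rewrite [leLHS](eq_bigl (fun n => (1 <= n < N.+1)%N && (n == 1%N))) // => n.
    case: (boolP (1 <= n < N.+1)%N) => //= /andP[n0 nN].
    apply/eqP/eqP => [h|->]; last first.
      by apply/setP => i; rewrite !inE.
    apply/eqP; rewrite eqn_leq n0 andbT leqNgt; apply/negP => n1.
    have hp : (pdiv n < z.+1)%N.
      by rewrite ltnS (leq_trans (pdiv_leq n0)) // (leq_trans _ Nz).
    have : Ordinal hp \in prime_support n by rewrite inE /= mem_primes pdiv_prime // n0 pdiv_dvd.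
    by rewrite h inE.
  rewrite big_mkcond /=; case: N {IH Nz} => [|N]; first by rewrite big_geq.
  rewrite big_ltn // eqxx invr1 big_nat_cond big1 ?addr0 // => n /andP[/andP[n1 _] _].
  by rewrite ifF //; apply: gtn_eqF.
case: (boolP (E \subset primes_upto)) => [sE|nE]; last first.
  rewrite big1 ?invr_ge0 ?ltW ?setphi_gt0 //; first exact: prime_weight_gt1.
  by move=> n /eqP h; rewrite -h prime_support_sub in nE.
have pq : prime q by have := subsetP sE q qE; rewrite inE.
have q0 := prime_gt0 pq.
rewrite [leLHS](_ : _ = \sum_(1 <= n < N.+1 | (q %| n)%N)
    if prime_support n == E then (n%:R^-1 : R) else 0); last first.
  rewrite big_mkcond [RHS]big_mkcond; apply: eq_bigr => n _ /=.
  case: eqP => [h|]; last by case: ifP.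
  by rewrite -h inE mem_primes in qE; case/and3P: qE => _ _ ->.
rewrite sum_multiples //.
have [N0|Npos] := posnP N.
  by rewrite N0 div0n big_geq // invr_ge0 ltW ?setphi_gt0 //; apply: prime_weight_gt1.
have lt : (N %/ q < N)%N by rewrite ltn_Pdiv ?prime_gt1.
have le : (N %/ q <= z)%N by rewrite (leq_trans (ltnW lt)).
apply: (@le_trans _ _ (q%:R^-1 * (\sum_(1 <= m < (N %/ q).+1 | prime_support m == E) (m%:R^-1 : R)
  + \sum_(1 <= m < (N %/ q).+1 | prime_support m == E :\ q) (m%:R^-1 : R)))).
  rewrite mulrDr !mulr_sumr [X in X + _]big_mkcond [X in _ + X]big_mkcond -big_split /=.
  rewrite big_nat_cond [leRHS]big_nat_cond; apply: ler_sum => m /andP[/andP[m0 _] _].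
  have c0 (b : bool) : 0 <= (if b then q%:R^-1 / m%:R else 0 : R).
    by case: b; rewrite // -invfM invr_ge0 -natrM.
  case: ifP => [/eqP h|_]; last by rewrite addr_ge0.
  have hm : m%:R != 0 :> R by rewrite pnatr_eq0 -lt0n.
  have hps i : (i \in E) = (i == q) || (i \in prime_support m).
    rewrite -h !inE primesM // primes_prime // inE.
    by rewrite -val_eqE.
  case: (boolP (q \in prime_support m)) => qm.
    rewrite (_ : prime_support m == E) ?natrM ?invfM ?lerDl ?c0 //.
    by apply/eqP/setP => i; rewrite hps; case: eqP => [->|].
  rewrite [X in _ + (if X then _ else _)](_ : _ = true) ?natrM ?invfM ?lerDr ?c0 //.
  apply/eqP/setP => i; rewrite in_setD1 hps; case: eqP => [->|] //=.
  exact: negbTE.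
have hphi : setphi prime_weight E = (q%:R - 1) * setphi prime_weight (E :\ q).
  by rewrite /setphi (big_setD1 q) //= prime_weightE.
have q1 : 0 < q%:R - 1 :> R by rewrite subr_gt0 ltr1n prime_gt1.
have h2 : 0 < setphi prime_weight (E :\ q) by apply/setphi_gt0/prime_weight_gt1.
apply: (@le_trans _ _ (q%:R^-1 * ((setphi prime_weight E)^-1 + (setphi prime_weight (E :\ q))^-1))).
  by rewrite ler_wpM2l ?invr_ge0 ?ler0n // lerD // IH.
have hq : q%:R != 0 :> R by rewrite pnatr_eq0 -lt0n.
rewrite hphi le_eqVlt; apply/orP; left; apply/eqP.
by field; rewrite hq !gt_eqF.
Qed.

Lemma prod_prime_support_dvd n : (\prod_(q in prime_support n) (q : nat) %| n)%N.
Proof.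
rewrite prod_primes_dvd ?prime_support_sub //; apply/subsetP => q.
by rewrite !inE mem_primes => /and3P[].
Qed.

(** Group the integers up to [z] by their sets of prime factors, each of which
    has product at most [z]. *)
Lemma harmonic_le_selberg_G :
  \sum_(1 <= n < z.+1) (n%:R^-1 : R)
    <= selberg_G prime_weight (selberg_support prime_weight primes_upto z%:R).
Proof.
set V := selberg_support _ _ _.
have hV n : (1 <= n < z.+1)%N -> V (prime_support n).
  move=> /andP[n0 nz]; rewrite /V /selberg_support prime_support_sub /=.
  rewrite setprod_primesE ?prime_support_sub // ler_nat.
  by rewrite (leq_trans (dvdn_leq n0 (prod_prime_support_dvd n))).
rewrite big_nat_cond (partition_big prime_support V) /=; last first.
  by move=> n /andP[/hV].
apply: ler_sum => E _.
rewrite (eq_bigl (fun n => (1 <= n < z.+1)%N && (prime_support n == E))).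
  by rewrite -big_nat_cond sum_inv_prime_support.
by move=> n; rewrite andbT.
Qed.

Lemma prod_primes_totient_le (D : nat) : (0 < D)%N ->
  setprod prime_weight (prime_support D) / setphi prime_weight (prime_support D)
    <= D%:R / (totient D)%:R.
Proof.
move=> D0; rewrite /setprod /setphi -prodf_div.
pose f (q : nat) : R := q%:R / (q%:R - 1).
have -> : D%:R / (totient D)%:R = \prod_(q <- primes D) f q.
  rewrite totientE // {1}(prod_prime_decomp D0) prime_decompE big_map /=.
  rewrite !natr_prod -prodf_div big_seq [RHS]big_seq; apply: eq_bigr => q.
  move=> qD; have := qD; rewrite mem_primes => /and3P[pq _ _].
  have : (0 < logn q D)%N by rewrite logn_gt0.
  case: (logn q D) => // e _ /=; rewrite natrM expnS natrM /f -subn1.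
  rewrite natrB ?prime_gt0 //.
  have h1 : (q ^ e)%:R != 0 :> R by rewrite pnatr_eq0 -lt0n expn_gt0 prime_gt0.
  have h2 : q%:R - 1 != 0 :> R by rewrite subr_eq0 pnatr_eq1; case: q pq {h1 qD} => [|[]].
  by field; rewrite h1 h2.
have f1 (q : nat) : prime q -> 1 <= f q.
  move=> pq; have : 0 < q%:R - 1 :> R by rewrite subr_gt0 ltr1n prime_gt1.
  by move=> h; rewrite /f ler_pdivlMr // mul1r lerBlDr lerDl.
apply: (@le_trans _ _ (\prod_(q <- primes D | (q < z.+1)%N) f q)).
  rewrite le_eqVlt; apply/orP; left; apply/eqP.
  transitivity (\prod_(q in prime_support D) f q).
    apply: eq_bigr => q; rewrite inE mem_primes => /and3P[pq _ _].
    by rewrite prime_weightE.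
  rewrite -[RHS]big_filter -[LHS]big_enum -(big_map val predT f) /=.
  apply: perm_big; apply: uniq_perm.
  - by rewrite map_inj_uniq ?enum_uniq //; apply: val_inj.
  - by rewrite filter_uniq ?primes_uniq.
  move=> q; rewrite mem_filter; apply/mapP/andP => [[i iD ->] | [qz qD]].
    by move: iD; rewrite mem_enum inE => iD; rewrite ltn_ord.
  by exists (Ordinal qz) => //; rewrite mem_enum inE.
rewrite big_mkcond big_seq [leRHS]big_seq; apply: ler_prod => q.
rewrite mem_primes => /and3P[pq _ _]; have := f1 q pq.
by case: ifP => _ h; rewrite ?ler01 // lexx andbT (le_trans ler01).
Qed.
End PrimeSets.

(** * The sieve in an arithmetic progression *)

Section ProgressionCount.
Variables (D q : nat).
Hypotheses (q0 : (0 < q)%N) (cop : coprime q D).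

Lemma window_count N : (\sum_(m < q) (q %| N + D * m) = 1)%N.
Proof.
pose f (m : 'I_q) : 'I_q := Ordinal (ltn_pmod (N + D * m) q0).
have fI : injective f.
  suff h (i j : 'I_q) : (i <= j)%N -> f i = f j -> i = j.
    by move=> i j e; case/orP: (leq_total i j) => /h ->.
  move=> ij [] /eqP; rewrite eq_sym eqn_modDl eqn_mod_dvd ?leq_mul2l ?ij ?orbT //.
  rewrite -mulnBr Gauss_dvdr // => dv; apply/val_inj/eqP; rewrite eqn_leq ij /=.
  rewrite leqNgt -subn_gt0; apply/negP => pos.
  have := dvdn_leq pos dv; rewrite leqNgt; move/negP; apply.
  by rewrite (leq_ltn_trans (leq_subr _ _)).
transitivity (\sum_(m < q) (f m == Ordinal q0))%N.
  by apply: eq_bigr => m _.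
rewrite -(reindex_inj fI (P := predT) (F := fun j => nat_of_bool (j == Ordinal q0))) /=.
by rewrite (bigD1 (Ordinal q0)) // eqxx big1 // => i /negPf ->.
Qed.

(** Windows of length [q] contain exactly one multiple of [q], so the error
    comes from a last incomplete window. *)
Lemma progression_count (R : realFieldType) N H :
  `|(\sum_(m < H) (q %| N + D * m))%N%:R - H%:R / q%:R : R| <= 1.
Proof.
have qp : 0 < q%:R :> R by rewrite ltr0n.
elim/ltn_ind: H N => H IH N.
case: (ltnP H q) => [lt|le].
  have c1 : (\sum_(m < H) (q %| N + D * m) <= 1)%N.
    rewrite -(window_count N) -!(big_mkord predT (fun m => nat_of_bool (q %| N + D * m)%N)).
    by rewrite [X in (_ <= X)%N](big_cat_nat (leq0n H) (ltnW lt)) //= leq_addr.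
  have r0 : 0 <= H%:R / q%:R :> R by rewrite divr_ge0 ?ler0n.
  have r1 : H%:R / q%:R <= 1 :> R by rewrite ler_pdivrMr // mul1r ler_nat ltnW.
  by case: (\sum_(m < H) _)%N c1 => [|[|//]] _; rewrite ler_norml; lra.
have lt : (H - q < H)%N by rewrite ltn_subrL q0 (leq_trans q0 le).
have := IH _ lt (N + D * q)%N.
rewrite -[in X in _ -> X](subnKC le) big_split_ord /= window_count natrD.
rewrite (eq_bigr (fun m : 'I_(H - q) => nat_of_bool (q %| N + D * (q + m))%N)); last first.
  by move=> m _; rewrite mulnDr addnA.
congr (`| _ | <= 1); rewrite natrD mulrDl divff ?gt_eqF //; ring.
Qed.
End ProgressionCount.

Section SelbergProgression.
Variables (R : realFieldType) (z D : nat).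
Hypotheses (z0 : (0 < z)%N) (D0 : (0 < D)%N).

Definition sieving_primes : {set 'I_z.+1} :=
  primes_upto z :\: prime_support z D.
Local Notation pw := (@prime_weight R z).
Local Notation V := (selberg_support pw sieving_primes z%:R).

Lemma sieving_primes_prime : sieving_primes \subset primes_upto z.
Proof. exact: subsetDl. Qed.

(** The sets in the support are determined by their products, which lie in
    [[1, z]]. *)
Lemma card_selberg_support : \sum_(A : {set 'I_z.+1} | V A) 1 <= z%:R :> R.
Proof.
rewrite sumr_const -mulr_natl mulr1 ler_nat.
pose f (A : {set 'I_z.+1}) : 'I_z.+1 := inord (\prod_(q in A) (q : nat)).
have V1 A : V A -> A \subset primes_upto z.
  by case/andP => /subset_trans-> //; apply: sieving_primes_prime.
have V2 A : V A -> (\prod_(q in A) (q : nat) <= z)%N.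
  by move=> VA; case/andP: (VA) => _; rewrite setprod_primesE ?V1 // ler_nat.
have V3 A q : V A -> (q \in A) = prime q && (q %| \prod_(q in A) (q : nat))%N.
  move=> VA; apply/idP/andP => [qA|[pq]].
    by split; [have := subsetP (V1 _ VA) q qA; rewrite inE | rewrite (bigD1 q) //= dvdn_mulr].
  rewrite Euclid_dvd_prod // big_orE => /existsP[s /andP[sA]].
  have := subsetP (V1 _ VA) s sA; rewrite inE => pi.
  by rewrite dvdn_prime2 // => /eqP /val_inj ->.
have fI : {in V &, injective f}.
  move=> A B VA VB /(congr1 val); rewrite /= !inordK ?ltnS ?V2 // => e.
  by apply/setP => q; rewrite (V3 _ _ VA) (V3 _ _ VB) e.
rewrite -(card_in_imset fI) -[leqRHS]/z.+1.-1 -[X in (_ <= X.-1)%N]card_ord.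
rewrite -(cardsC1 ord0); apply/subset_leq_card/subsetP => i /imsetP[A VA ->].
rewrite !inE -val_eqE /= inordK ?ltnS ?V2 // -lt0n.
apply: prodn_cond_gt0 => q qA.
by have := subsetP (V1 _ VA) q qA; rewrite inE => /prime_gt0.
Qed.

(** The square of [sum lambda] over the sieving divisors of [N + D m] majorizes
    the indicator of the sifted set; expanding it and counting multiples of the
    lcm gives the quadratic form and [z ^ 2] error terms of size at most [1]. *)
Lemma selberg_progression N H :
  (#|[set m : 'I_H | [forall q in sieving_primes, ~~ (q %| N + D * m)%N]]|)%:R
    <= H%:R / selberg_G pw V + z%:R ^+ 2 :> R.
Proof.
set lam := selberg_lambda pw V.
have V0 : V set0 by rewrite /selberg_support sub0set /setprod big_set0 ler1n.
have lam0 A : ~~ V A -> lam A = 0.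
  move=> nVA; rewrite /lam /selberg_lambda big1 ?mulr0 // => E /andP[VE sAE].
  case/negP: nVA; case/andP: VE => sE hE; rewrite /selberg_support (subset_trans sAE) //=.
  rewrite (le_trans _ hE) // /setprod [leRHS](big_setID A) /= (setIidPr sAE).
  rewrite ler_peMr ?(setprod_ge1 (@prime_weight_gt1 R z)) //.
  by rewrite ltW ?setprod_gt0 //; apply: prime_weight_gt1.
have lam1 A : `|lam A| <= 1.
  by apply: selberg_lambda_le1; [exact: prime_weight_gt1 | rewrite ler1n].
pose B (m : nat) := [set q in sieving_primes | (q %| N + D * m)%N].
apply: (@le_trans _ _ (\sum_(m < H) (\sum_(A : {set 'I_z.+1} | A \subset B m) lam A) ^+ 2)).
  rewrite -sum1_card natr_sum [leLHS]big_mkcond /=; apply: ler_sum => m _.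
  case: ifP => [|_]; last exact: sqr_ge0.
  rewrite inE => /forall_inP h.
  have -> : B m = set0.
    by apply/setP => q; rewrite in_set0 inE; apply/negbTE/negP => /andP[/h/negP].
  rewrite (eq_bigl (fun A => A == set0)); last by move=> A; rewrite subset0.
  rewrite big_pred1_eq /lam selberg_lambda0 ?expr1n //.
  exact: prime_weight_gt1.
have -> : \sum_(m < H) (\sum_(A : {set 'I_z.+1} | A \subset B m) lam A) ^+ 2 =
  \sum_(A : {set 'I_z.+1}) \sum_(A' : {set 'I_z.+1})
    lam A * lam A' * (\sum_(m < H) ((A :|: A') \subset B m))%N%:R.
  rewrite (eq_bigr (fun m : 'I_H => \sum_(A : {set 'I_z.+1}) \sum_(A' : {set 'I_z.+1})
     lam A * lam A' * ((A :|: A') \subset B m)%:R)); last first.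
    move=> m _; rewrite expr2 mulr_suml big_mkcond; apply: eq_bigr => A _.
    rewrite mulr_sumr [X in if _ then X else _]big_mkcond /=.
    case: ifP => sA.
      by apply: eq_bigr => A' _; rewrite subUset sA; case: ifP; rewrite ?mulr1 ?mulr0.
    by rewrite big1 // => A' _; rewrite subUset sA mulr0.
  rewrite exchange_big; apply: eq_bigr => A _; rewrite exchange_big; apply: eq_bigr => A' _.
  by rewrite natr_sum mulr_sumr.
rewrite -(selberg_quadratic_form (@prime_weight_gt1 R z) V0) -/lam.
rewrite mulr_sumr -lerBlDl -sumrB.
apply: (@le_trans _ _ (\sum_(A | V A) \sum_(A' | V A') 1)).
  rewrite [leRHS]big_mkcond; apply: ler_sum => A _.
  rewrite mulr_sumr -sumrB; case: ifP => [VA|/negbT/lam0 l0]; last first.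
    by rewrite big1 // => A' _; rewrite l0 !mul0r mulr0 subr0.
  rewrite [leRHS]big_mkcond; apply: ler_sum => A' _.
  case: ifP => [VA'|/negbT/lam0 l0]; last by rewrite l0 mulr0 !mul0r mulr0 subr0.
  have sU : A :|: A' \subset sieving_primes.
    by rewrite subUset; case/andP: VA => ->; case/andP: VA' => ->.
  have sU' := subset_trans sU sieving_primes_prime.
  rewrite (eq_bigr (fun m : 'I_H => nat_of_bool (\prod_(q in A :|: A') (q : nat) %| N + D * m)%N)).
    rewrite setprod_primesE // [X in _ - X]mulrCA -mulrBr.
    have X0 : (0 < \prod_(q in A :|: A') (q : nat))%N.
      by apply: prodn_cond_gt0 => q /(subsetP sU'); rewrite inE => /prime_gt0.
    have cop : coprime (\prod_(q in A :|: A') (q : nat)) D.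
      rewrite coprime_sym big_mkcond; elim/big_rec: _ => [|q x _ cx].
        exact: coprimen1.
      case: ifP => [qA|_]; rewrite coprimeMr cx andbT ?coprimen1 // coprime_sym.
      have := subsetP sU q qA; rewrite !inE => /andP[+ pq].
      by rewrite prime_coprime // mem_primes pq D0.
    rewrite (le_trans (ler_norm _)) // normrM [X in X * _ <= _]normrM.
    have := progression_count X0 cop R N H => hc.
    by rewrite mulr_ile1 ?mulr_ge0 ?mulr_ile1.
  move=> m _; congr nat_of_bool; rewrite prod_primes_dvd //.
  apply/subsetP/subsetP => h q qA; have := h q qA; rewrite !inE.
    by case/andP.
  by move=> ->; have := subsetP sU q qA; rewrite !inE => ->.
have hc := card_selberg_support.
apply: (@le_trans _ _ (\sum_(A | V A) z%:R)); first exact: ler_sum.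
rewrite -[X in \sum_(A | V A) X]mul1r -mulr_suml expr2.
by rewrite ler_wpM2r.
Qed.
End SelbergProgression.

(** * Harmonic sums and the Brun-Titchmarsh inequality *)

Section LogHarmonic.
Variable R : realType.

Lemma ln_natS_sub_le (n : nat) : (0 < n)%N ->
  ln (n.+1%:R : R) - ln n%:R <= n%:R^-1.
Proof.
move=> n0; have np : 0 < n%:R :> R by rewrite ltr0n.
rewrite -ln_div ?posrE ?ltr0n //.
have -> : n.+1%:R / n%:R = 1 + n%:R^-1 :> R.
  by rewrite -natr1 mulrDl divff ?gt_eqF // mul1r.
by rewrite le_ln1Dx // (lt_trans _ (_ : 0 < n%:R^-1)) ?invr_gt0 // ltrN10.
Qed.

Lemma inv_natS_le (n : nat) : (0 < n)%N ->
  n.+1%:R^-1 <= ln (n.+1%:R : R) - ln n%:R.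
Proof.
move=> n0; have np : 0 < n%:R :> R by rewrite ltr0n.
have sp : 0 < n.+1%:R :> R by rewrite ltr0n.
rewrite -lerN2 opprB -ln_div ?posrE //.
have -> : n%:R / n.+1%:R = 1 + (- n.+1%:R^-1) :> R.
  have e : n%:R = n.+1%:R - 1 :> R by rewrite -natr1 addrK.
  by rewrite {1}e mulrBl divff ?gt_eqF // mul1r.
by rewrite le_ln1Dx // ltrN2 invf_lt1 // ltr1n.
Qed.

Lemma ln_le_harmonic (z : nat) : (0 < z)%N ->
  ln (z%:R : R) <= \sum_(1 <= n < z.+1) n%:R^-1.
Proof.
move=> z0; apply: (@le_trans _ _ (ln (z.+1%:R : R))).
  by rewrite ler_ln ?posrE ?ltr0n // ler_nat.
elim: z {z0} => [|z IH]; first by rewrite ln1 big_geq.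
rewrite big_nat_recr //= -lerBlDr (le_trans _ IH) // lerBlDr -lerBlDl.
exact: ln_natS_sub_le.
Qed.

Lemma sum_inv_le_ln (a b : nat) : (0 < a)%N -> (a <= b)%N ->
  \sum_(a <= n < b) (n%:R^-1 : R) <= a%:R^-1 + (ln b%:R - ln a%:R).
Proof.
move=> a0 ab; rewrite -(subnKC ab); case: (b - a)%N => [|k] {b ab}.
  by rewrite addn0 big_geq // subrr addr0 invr_ge0.
apply: (@le_trans _ _ (a%:R^-1 + (ln (a + k)%:R - ln a%:R))); last first.
  rewrite lerD2l lerD2r ler_ln ?posrE ?ltr0n ?addn_gt0 ?a0 //.
  by rewrite ler_nat leq_add2l.
elim: k => [|k IH]; first by rewrite addn0 addn1 big_nat1 subrr addr0.
rewrite addnS big_nat_recr ?leq_addr //=.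
have := inv_natS_le (n := (a + k)%N); rewrite addn_gt0 a0 => /(_ isT).
move: IH; rewrite !addnS => h1 h2; apply: (le_trans (lerD h1 h2)).
  by rewrite le_eqVlt; apply/orP; left; apply/eqP; ring.
Qed.

End LogHarmonic.

(** Sieving only by the primes not dividing [D] decreases the main term [G] by
    at most the factor [phi(D) / D], so that [G >= (phi(D) / D) ln z]. *)
Lemma brun_titchmarsh_progression (R : realType) (D z N H : nat) :
  (0 < D)%N -> (1 < z)%N -> (z < N)%N ->
  (#|[set m : 'I_H | prime (N + D * m)]|)%:R
    <= H%:R * D%:R / ((totient D)%:R * ln z%:R) + z%:R ^+ 2 :> R.
Proof.
move=> D0 z1 zN; have z0 := ltnW z1.
have lz : 0 < ln z%:R :> R by rewrite ln_gt0 // ltr1n.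
have tot0 : 0 < (totient D)%:R :> R by rewrite ltr0n totient_gt0.
have Dp : 0 < D%:R :> R by rewrite ltr0n.
have := selberg_progression R z0 D0 N H.
set G := selberg_G _ _ => hS.
have hG : (totient D)%:R / D%:R * ln z%:R <= G.
  have h1 : ln z%:R <= D%:R / (totient D)%:R * G.
    apply: le_trans (ln_le_harmonic R z0) _.
    apply: le_trans (harmonic_le_selberg_G R z) _.
    apply: le_trans (selberg_G_discard (@prime_weight_gt1 R z) _ (prime_support z D) _) _.
    rewrite ler_wpM2r ?prod_primes_totient_le // ltW //.
    apply: selberg_G_gt0; first exact: prime_weight_gt1.
    by rewrite /selberg_support sub0set /setprod big_set0 ler1n.
  rewrite mulrAC ler_pdivrMr // -ler_pdivlMl // mulrC.
  by rewrite (le_trans h1) // le_eqVlt; apply/orP; left; apply/eqP; ring.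
apply: (@le_trans _ _
  (#|[set m : 'I_H | [forall q in sieving_primes z D, ~~ (q %| N + D * m)%N]]|%:R)).
  rewrite ler_nat; apply/subset_leq_card/subsetP => m; rewrite !inE => pm.
  apply/forall_inP => q; rewrite !inE => /andP[_ pq].
  rewrite dvdn_prime2 // neq_ltn (leq_ltn_trans (_ : q <= z)%N) ?(leq_trans zN) ?leq_addr //.
  by rewrite -ltnS.
apply: (le_trans hS); rewrite lerD2r -mulrA ler_wpM2l //.
have Gp : 0 < (totient D)%:R / D%:R * ln z%:R :> R by rewrite mulr_gt0 ?divr_gt0.
have -> : D%:R / ((totient D)%:R * ln z%:R) = ((totient D)%:R / D%:R * ln z%:R)^-1 :> R.
  by field; rewrite !gt_eqF.
by rewrite lef_pV2 ?posrE // (lt_le_trans Gp).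
Qed.

(** * Mertens' theorem *)

Lemma prime_dvd_fact (p m : nat) : prime p -> (p %| m`!)%N -> (p <= m)%N.
Proof.
move=> pp; elim: m => [|m IH]; first by rewrite dvdn1 => /eqP p1; rewrite p1 in pp.
rewrite factS Euclid_dvdM // => /orP[/dvdn_leq -> //|/IH h].
exact: leqW.
Qed.

Lemma central_bin_le (m : nat) : ('C(m + m, m) <= 2 ^ (m + m))%N.
Proof.
rewrite -[2%N]/(1 + 1)%N expnDn (bigD1 (inord m)) //= inordK ?ltnS ?leq_addr //.
by rewrite !exp1n !muln1 leq_addr.
Qed.

(** The primes between [m] and [2 m] divide the central binomial
    coefficient. *)
Lemma prod_primes_dyadic_le (m : nat) :
  (\prod_(m.+1 <= p < (m + m).+1 | prime p) p <= 2 ^ (m + m))%N.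
Proof.
rewrite (leq_trans _ (central_bin_le m)) // dvdn_leq //.
  by rewrite bin_gt0 leq_addr.
rewrite big_nat_cond.
apply/Gauss_dvd_prod => [|p]; last first.
  rewrite mem_index_iota ltnS => /andP[mp pm] /andP[_ pp].
  have : (p %| (m + m)`!)%N by rewrite dvdn_fact // pm prime_gt0.
  rewrite -(@bin_fact (m + m) m) ?leq_addr // addnK !Euclid_dvdM // orbb.
  by case/orP => // /(prime_dvd_fact pp); rewrite leqNgt mp.
rewrite map_id; set s := [seq _ <- _ | _].
have := uniq_pairwise s; rewrite filter_uniq ?iota_uniq // => /esym.
apply: (@sub_in_pairwise _ prime) => [p q pp pq /=|].
  by rewrite prime_coprime // dvdn_prime2.
by apply/allP => p; rewrite mem_filter => /andP[/andP[]].
Qed.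

Section Mertens.
Variable R : realType.

Lemma ln_prod_nat (I : Type) (r : seq I) (P : pred I) (f : I -> nat) :
  (forall i, P i -> (0 < f i)%N) ->
  ln ((\prod_(i <- r | P i) f i)%N%:R : R) = \sum_(i <- r | P i) ln (f i)%:R.
Proof.
move=> f0; suff [_ //] : (0 < \prod_(i <- r | P i) f i)%N /\
  ln ((\prod_(i <- r | P i) f i)%N%:R : R) = \sum_(i <- r | P i) ln (f i)%:R.
elim/big_rec2: _ => [|i n s Pi [s0 e]]; first by rewrite ln1.
by rewrite muln_gt0 s0 f0 // natrM lnM ?posrE ?ltr0n ?f0 // e.
Qed.

Lemma ln_nat_ge0 (n : nat) : 0 <= ln (n%:R : R).
Proof. by case: n => [|n]; [rewrite ln0 | rewrite ln_ge0 // ler1n]. Qed.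

Lemma ln_pow2 (k : nat) : ln ((2 ^ k)%N%:R : R) = k%:R * ln 2.
Proof. by rewrite natrX lnXn // mulr_natl. Qed.

(** Chebyshev's bound, by adding up the dyadic estimates
    [prod_primes_dyadic_le]. *)
Lemma theta_pow2_le (k : nat) :
  \sum_(1 <= p < (2 ^ k).+1 | prime p) ln (p%:R : R) <= (2 ^ k.+1)%:R * ln 2.
Proof.
elim: k => [|k IH].
  rewrite big_nat_cond big1 ?mulr_ge0 ?(ln_nat_ge0 2) // => p.
  by rewrite expn0 => /andP[/andP[p0 p1] pp]; case: p p0 p1 pp => [|[]].
have e : (2 ^ k.+1 = 2 ^ k + 2 ^ k)%N by rewrite expnS mul2n addnn.
rewrite (@big_cat_nat _ _ _ (2 ^ k).+1) //=; last by rewrite e ltnS leq_addr.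
rewrite [X in _ <= X%:R * _](_ : _ = 2 ^ k.+1 + 2 ^ k.+1)%N; last by rewrite expnS mul2n addnn.
rewrite natrD mulrDl lerD // {1}e -ln_prod_nat; last by move=> p /prime_gt0.
rewrite mulrC mulr_natr -lnXn // -natrX ler_ln ?posrE ?ltr0n ?expn_gt0 //.
  by rewrite ler_nat e prod_primes_dyadic_le.
by rewrite prodn_cond_gt0 // => p /prime_gt0.
Qed.

(** The upper limit [m] is independent of [n] so that all integers up to [n]
    are factored over the same range of primes. *)
Lemma ln_fact (m n : nat) : (n <= m)%N ->
  ln ((n`!)%:R : R) = \sum_(1 <= p < m.+1 | prime p) (logn p n`!)%:R * ln p%:R.
Proof.
elim: n => [|n IH] nm.
  by rewrite fact0 ln1 big1 // => p _; rewrite logn1 mul0r.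
rewrite factS natrM lnM ?posrE ?ltr0n ?fact_gt0 // IH ?(ltnW nm) //.
under [RHS]eq_bigr => p pp do rewrite lognM ?fact_gt0 // natrD mulrDl.
rewrite big_split /=; congr (_ + _).
have := widen_partn predT nm; rewrite partnT // => e.
have l0 p : ~~ prime p -> logn p n.+1 = 0%N by rewrite lognE => /negPf ->.
rewrite {1}e ln_prod_nat => [|p _]; last first.
  by case: (posnP p) => [->|p0]; [rewrite l0 | rewrite expn_gt0 p0].
rewrite big_ltn // l0 // expn0 ln1 add0r [RHS]big_mkcond.
rewrite big_nat_cond [RHS]big_nat_cond; apply: eq_bigr => p /andP[/andP[p0 _] _].
case: ifP => [_|/negbT/l0 ->]; last by rewrite expn0 ln1.
by rewrite natrX lnXn ?ltr0n // mulr_natl.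
Qed.

Lemma ln_fact_ge (n : nat) : n%:R * ln (n%:R : R) - n%:R <= ln (n`!)%:R.
Proof.
elim: n => [|n IH]; first by rewrite mul0r subr0 fact0 ln1.
rewrite factS natrM lnM ?posrE ?ltr0n ?fact_gt0 //.
case: n IH => [|n] IH; first by rewrite ln1; lra.
have := ln_natS_sub_le R (n := n.+1) isT.
rewrite -(ler_pM2l (_ : 0 < n.+1%:R)) ?ltr0n // divff ?pnatr_eq0 //.
move: IH; set a := ln n.+1%:R; set b := ln n.+2%:R; set c := ln _ => IH h.
rewrite -[n.+2%:R]natr1 mulrDl mul1r; nra.
Qed.

Lemma ln_fact_le (n : nat) : ln ((n`!)%:R : R) <= n%:R * ln (n%:R : R).
Proof.
elim: n => [|n IH]; first by rewrite mul0r fact0 ln1.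
rewrite factS natrM lnM ?posrE ?ltr0n ?fact_gt0 // -[X in X * _]natr1 mulrDl mul1r addrC.
rewrite lerD2r (le_trans IH) // ler_wpM2l //.
case: n {IH} => [|n]; first by rewrite ln0 // ln1.
by rewrite ler_ln ?posrE ?ltr0n // ler_nat.
Qed.

Lemma logn_fact_le (p n : nat) : prime p ->
  (logn p n`!)%:R <= n%:R / (p%:R - 1) :> R.
Proof.
move=> pp; have p1 : 1 < p%:R :> R by rewrite ltr1n prime_gt1.
have p10 : 0 < p%:R - 1 :> R by rewrite subr_gt0.
rewrite logn_fact // natr_sum.
apply: (@le_trans _ _ (\sum_(1 <= k < n.+1) n%:R / p%:R ^+ k)).
  apply: ler_sum => k _; rewrite ler_pdivlMr ?exprn_gt0 ?(lt_trans ltr01) //.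
  by rewrite -natrX -natrM ler_nat leq_trunc_div.
rewrite -mulr_sumr ler_wpM2l //.
suff -> : \sum_(1 <= k < n.+1) (p%:R ^+ k)^-1 = (1 - (p%:R ^+ n)^-1) / (p%:R - 1) :> R.
  rewrite ler_pdivrMr // mulVf ?gt_eqF // lerBlDr lerDl invr_ge0 exprn_ge0 //.
elim: n => [|n IH]; first by rewrite big_geq // expr0 invr1 subrr mul0r.
rewrite big_nat_recr //= IH exprS.
have h : p%:R ^+ n != 0 :> R by rewrite expf_neq0 // gt_eqF // (lt_trans ltr01).
by field; rewrite h !gt_eqF // (lt_trans ltr01).
Qed.

Lemma logn_fact_ge (p n : nat) : prime p -> (p <= n)%N ->
  n%:R / p%:R - 1 <= (logn p n`!)%:R :> R.
Proof.
move=> pp pn; have n0 : (0 < n)%N by rewrite (leq_trans (prime_gt0 pp)).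
apply: (@le_trans _ _ ((n %/ p)%N%:R)); last first.
  by rewrite ler_nat logn_fact // big_ltn // expn1 leq_addr.
rewrite lerBlDr ler_pdivrMr ?ltr0n ?prime_gt0 // natr1 -natrM ler_nat.
by rewrite ltnW // ltn_ceil // prime_gt0.
Qed.

(** [(ln n + 2) / n] is a primitive, up to sign, of a majorant of
    [ln n / (n (n - 1))]. *)
Lemma sum_ln_div_le (n : nat) :
  \sum_(2 <= k < n.+2) ln (k%:R : R) / (k%:R * (k%:R - 1)) <= 2 - (ln n.+1%:R + 2) / n.+1%:R.
Proof.
elim: n => [|n IH]; first by rewrite big_geq // ln1 add0r divr1 subrr.
rewrite big_nat_recr //=; apply: (le_trans (lerD IH (lexx _))).
have := ln_natS_sub_le R (n := n.+1) isT.
set a := ln n.+1%:R; set b := ln n.+2%:R.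
have -> : n.+2%:R = n.+1%:R + 1 :> R by rewrite natr1.
have : 0 < n.+1%:R :> R by rewrite ltr0n.
have : 1 <= n.+1%:R :> R by rewrite ler1n.
move: (n.+1%:R : R) => m m1 m0 h.
have h2 : (m + 1) * (b - a) <= 2.
  apply: (@le_trans _ _ ((m + 1) * m^-1)); first by rewrite ler_wpM2l // addr_ge0 // ltW.
  by rewrite ler_pdivrMr //; lra.
rewrite -subr_le0.
have -> : 2 - (a + 2) / m + b / ((m + 1) * (m + 1 - 1)) - (2 - (b + 2) / (m + 1))
   = ((m + 1) * (b - a) - 2) / (m * (m + 1)).
  by field; rewrite !gt_eqF //; lra.
by rewrite ler_pdivrMr ?mul0r ?subr_le0 // mulr_gt0 //; lra.
Qed.

Definition mertens_sum (n : nat) : R :=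
  \sum_(1 <= p < n.+1 | prime p) ln p%:R / p%:R.

(** [n ln n - n <= ln n! <= sum n ln p / (p - 1)], and passing from [p - 1]
    to [p] costs the convergent sum of [ln k / (k (k - 1))], at most [2]. *)
Lemma mertens_sum_ge (n : nat) : (0 < n)%N -> ln n%:R - 3 <= mertens_sum n.
Proof.
move=> n0; have np : 0 < n%:R :> R by rewrite ltr0n.
have h1 : ln n%:R - 1 <= \sum_(1 <= p < n.+1 | prime p) ln (p%:R : R) / (p%:R - 1).
  rewrite -(ler_pM2l np) mulrBr mulr1 (le_trans (ln_fact_ge n)) // (ln_fact (leqnn n)).
  rewrite mulr_sumr; apply: ler_sum => p pp.
  rewrite mulrCA mulrC ler_wpM2l ?ln_nat_ge0 //.
  exact: logn_fact_le.
have h2 : \sum_(1 <= p < n.+1 | prime p) ln (p%:R : R) / (p%:R - 1) <= mertens_sum n + 2.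
  apply: (@le_trans _ _ (mertens_sum n + \sum_(2 <= k < n.+1) ln (k%:R : R) / (k%:R * (k%:R - 1)))).
    rewrite /mertens_sum -lerBlDl -sumrB.
    rewrite big_ltn_cond //= big_mkcond /=.
    rewrite [leLHS]big_nat_cond [leRHS]big_nat_cond; apply: ler_sum => p /andP[/andP[p2 _] _].
    have p1 : 1 < p%:R :> R by rewrite ltr1n.
    have p0 : 0 < p%:R :> R by rewrite (lt_trans ltr01).
    have p10 : 0 < p%:R - 1 :> R by rewrite subr_gt0.
    case: ifP => _; last by rewrite divr_ge0 ?ln_nat_ge0 // mulr_ge0 // ltW.
    by rewrite le_eqVlt; apply/orP; left; apply/eqP; field; rewrite !gt_eqF.
  rewrite lerD2l; case: n n0 {np h1} => // n _; apply: le_trans (sum_ln_div_le n) _.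
  by rewrite gerBl divr_ge0 // addr_ge0 // ln_nat_ge0.
lra.
Qed.

(** [sum (n/p - 1) ln p <= ln n! <= n ln n], with Chebyshev's bound for
    [sum ln p]. *)
Lemma mertens_sum_pow2_le (k : nat) : mertens_sum (2 ^ k) <= k%:R * ln 2 + 2 * ln 2.
Proof.
set n := (2 ^ k)%N; have n0 : (0 < n)%N by rewrite expn_gt0.
have np : 0 < n%:R :> R by rewrite ltr0n.
have ln2 : 0 <= ln 2 :> R := ln_nat_ge0 2.
rewrite -(ler_pM2l np).
have -> : n%:R * (k%:R * ln 2 + 2 * ln 2) = n%:R * ln n%:R + (2 ^ k.+1)%:R * ln 2 :> R.
  by rewrite ln_pow2 expnS natrM -/n; ring.
apply: le_trans (lerD (ln_fact_le n) (theta_pow2_le k)).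
rewrite -/n (ln_fact (leqnn n)) -big_split /= /mertens_sum mulr_sumr.
rewrite [leLHS]big_nat_cond [leRHS]big_nat_cond;  apply: ler_sum => p /andP[/andP[_ pn] pp].
rewrite mulrCA [X in _ <= _ + X](_ : _ = 1 * ln p%:R) ?mul1r // -[X in _ + X]mul1r -mulrDl mulrC.
by rewrite ler_wpM2r ?ln_nat_ge0 // -lerBlDr logn_fact_ge.
Qed.

Lemma abel_sum_le (c b : nat -> R) (C : R) (n : nat) :
  (forall m, \sum_(i < m) c i <= C) ->
  (forall i, 0 <= b i) -> (forall i, b i.+1 <= b i) ->
  \sum_(i < n) c i * b i <= C * b 0%N.
Proof.
move=> hC b0 bd.
have C0 : 0 <= C by have := hC 0%N; rewrite big_ord0.
case: n => [|n]; first by rewrite big_ord0 mulr_ge0.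
suff h : \sum_(i < n.+1) c i * b i <= C * (b 0%N - b n) + (\sum_(i < n.+1) c i) * b n.
  apply: (le_trans h); have := hC n.+1; have := b0 n; nra.
elim: n => [|n IH]; first by rewrite !big_ord1 subrr mulr0 add0r.
rewrite big_ord_recr /= [X in _ + X * _]big_ord_recr /=.
have := hC n.+1; have := bd n; move: IH; set S := \sum_(i < n.+1) c i.
nra.
Qed.

Lemma mertens_sum_sub (m n : nat) : (m <= n)%N ->
  mertens_sum n - mertens_sum m = \sum_(m.+1 <= p < n.+1 | prime p) ln p%:R / p%:R.
Proof.
by move=> mn; rewrite /mertens_sum (@big_cat_nat _ _ _ m.+1) //= addrAC subrr add0r.
Qed.

Lemma sum_inv_primes_ge (m k : nat) : (0 < k)%N -> (m <= 2 ^ k)%N ->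
  (mertens_sum (2 ^ k) - mertens_sum m) / (k%:R * ln 2)
    <= \sum_(m.+1 <= p < (2 ^ k).+1 | prime p) (p%:R^-1 : R).
Proof.
move=> k0 mk; rewrite mertens_sum_sub // mulr_suml.
have l2 : 0 < ln 2 :> R by rewrite ln_gt0 // ltr1n.
rewrite [leLHS]big_nat_cond [leRHS]big_nat_cond; apply: ler_sum => p /andP[/andP[mp pk] pp].
have p0 : 0 < p%:R :> R by rewrite ltr0n prime_gt0.
rewrite ler_pdivrMr ?mulr_gt0 ?ltr0n // mulrC ler_wpM2l ?invr_ge0 ?(ltW p0) //.
by rewrite -ln_pow2 ler_ln ?posrE ?ltr0n ?expn_gt0 ?prime_gt0 // ler_nat.
Qed.

Lemma sum_inv_primes_le (k l : nat) : (0 < k)%N -> (k <= l)%N ->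
  \sum_((2 ^ k).+1 <= p < (2 ^ l).+1 | prime p) (p%:R^-1 : R)
    <= ((l - k)%:R * ln 2 + 3 + 2 * ln 2) / (k%:R * ln 2).
Proof.
move=> k0 kl; have l2 : 0 < ln 2 :> R by rewrite ln_gt0 // ltr1n.
rewrite ler_pdivlMr ?mulr_gt0 ?ltr0n //.
have h1 := mertens_sum_pow2_le l.
have := mertens_sum_ge (n := (2 ^ k)%N); rewrite expn_gt0 => /(_ isT).
rewrite ln_pow2 => h2.
apply: (@le_trans _ _ (mertens_sum (2 ^ l) - mertens_sum (2 ^ k))); last first.
  by rewrite natrB // mulrBl; lra.
rewrite mertens_sum_sub ?leq_exp2l // mulr_suml.
rewrite [leLHS]big_nat_cond [leRHS]big_nat_cond; apply: ler_sum => p /andP[/andP[mp pk] pp].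
have p0 : 0 < p%:R :> R by rewrite ltr0n prime_gt0.
rewrite mulrC ler_wpM2r ?invr_ge0 ?(ltW p0) //.
rewrite -ln_pow2 ler_ln ?posrE ?ltr0n ?expn_gt0 ?prime_gt0 //.
by rewrite ler_nat ltnW.
Qed.

(** The constant of [harmonic_le_primes]: the two error terms of Mertens'
    theorem over the length [5 ln 2 = ln 32] of a scale, plus [1] for a shift
    of the index. *)
Definition harmonic_defect : R := (3 + 2 * ln 2) / (5 * ln 2) + 1.

(** Mertens' theorem in the scales [(32^k, 32^(k+1)]], summed by parts; the sum
    over the primes keeps the sharp constant [1]. *)
Lemma harmonic_le_primes (i0 n : nat) : (0 < i0)%N ->
  \sum_(i < n) ((i0 + i)%:R^-1 : R) <=
  \sum_((32 ^ i0).+1 <= p < (32 ^ (i0 + n)).+1 | prime p) p%:R^-1 + harmonic_defect.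
Proof.
move=> i00; have l2 : 0 < ln 2 :> R by rewrite ln_gt0 // ltr1n.
(* [b i] is a lower bound of [ln 32 / ln p] in the scale [k = i0 + i], and [a i]
   is the contribution of that scale to the Mertens sum, divided by [ln 32]: the
   partial sums of [1 - a i] are bounded above. *)
pose b i : R := (i0 + i).+1%:R^-1.
have e32 i : (32 ^ i = 2 ^ (5 * i))%N by rewrite expnM.
pose a i : R := (mertens_sum (32 ^ (i0 + i).+1) - mertens_sum (32 ^ (i0 + i))) / (5 * ln 2).
have hP : \sum_(i < n) a i * b i <=
    \sum_((32 ^ i0).+1 <= p < (32 ^ (i0 + n)).+1 | prime p) p%:R^-1.
  elim: n => [|n IH]; first by rewrite big_ord0 sumr_ge0.
  rewrite big_ord_recr /= (@big_cat_nat _ _ _ (32 ^ (i0 + n)).+1) //=; last 2 first.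
  - by rewrite ltnS leq_exp2l // leq_addr.
  - by rewrite ltnS leq_exp2l // leq_add2l.
  apply: lerD => //; rewrite addnS.
  have := @sum_inv_primes_ge (32 ^ (i0 + n)) (5 * (i0 + n).+1) isT.
  rewrite -e32 leq_exp2l // => /(_ (leqnSn _)); apply: le_trans.
  rewrite /a /b le_eqVlt; apply/orP; left; apply/eqP.
  by rewrite natrM; field; rewrite gt_eqF /=.
have hA m : \sum_(i < m) (1 - a i) <= (3 + 2 * ln 2) / (5 * ln 2).
  rewrite sumrB sumr_const card_ord -[X in X - _]mulr_natl mulr1.
  have -> : \sum_(i < m) a i = (mertens_sum (32 ^ (i0 + m)) - mertens_sum (32 ^ i0)) / (5 * ln 2).
    elim: m => [|m IH]; first by rewrite big_ord0 addn0 subrr mul0r.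
    by rewrite big_ord_recr /= IH /a -mulrDl addnS addrC subrKA.
  have h1 := mertens_sum_ge (n := (32 ^ (i0 + m))%N).
  have h2 := mertens_sum_pow2_le (5 * i0); rewrite -e32 in h2.
  move: h1; rewrite expn_gt0 /= => /(_ isT); rewrite {1}e32 ln_pow2 => h1.
  rewrite lerBlDr -mulrDl ler_pdivlMr ?mulr_gt0 //.
  move: h1 h2; rewrite !natrM natrD; nra.
have := @abel_sum_le (fun i => 1 - a i) b _ n hA.
have b0 i : 0 <= b i by rewrite invr_ge0.
have bd i : b i.+1 <= b i by rewrite lef_pV2 ?posrE ?ltr0n // ler_nat !ltnS leq_add2l.
move=> /(_ b0 bd) hs.
have hshift : \sum_(i < n) ((i0 + i)%:R^-1 : R) <= \sum_(i < n) b i + 1.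
  suff : \sum_(i < n) ((i0 + i)%:R^-1 : R) = \sum_(i < n) b i + i0%:R^-1 - (i0 + n)%:R^-1.
    move=> ->; rewrite -addrA lerD2l lerBlDr.
    by rewrite (@le_trans _ _ 1) ?invf_le1 ?ltr0n ?ler1n // lerDl invr_ge0.
  elim: n {hP hs} => [|n IH]; first by rewrite !big_ord0 addn0 add0r subrr.
  rewrite !big_ord_recr /= IH /b addnS; ring.
have b01 : b 0%N <= 1 by rewrite invf_le1 ?ltr0n // ler1n.
have d0 : 0 <= (3 + 2 * ln 2) / (5 * ln 2) :> R by rewrite divr_ge0 // ?addr_ge0 ?mulr_ge0 ?ltW.
move: hs; under eq_bigr do rewrite mulrBl mul1r.
rewrite sumrB /harmonic_defect; move: d0; set d := _ / _ => d0 hs.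
have : d * b 0%N <= d by rewrite ler_piMr.
lra.
Qed.

End Mertens.

(** * A lower bound for the Fejer kernel *)

Section Fejer.
Variable C : numClosedFieldType.

Lemma sum_square_differences (N : nat) :
  \sum_(k < N) \sum_(l < N) (k%:R - l%:R) ^+ 2
    = N%:R ^+ 2 * (N%:R ^+ 2 - 1) / 6 :> C.
Proof.
have h6 : (6 : C) != 0 by rewrite pnatr_eq0.
have h2 : (2 : C) != 0 by rewrite pnatr_eq0.
have inner (x : C) M : \sum_(l < M) (x - l%:R) ^+ 2
    = M%:R * x ^+ 2 - M%:R * (M%:R - 1) * x + M%:R * (M%:R - 1) * (2 * M%:R - 1) / 6.
  elim: M => [|M IH]; first by rewrite big_ord0; field.
  by rewrite big_ord_recr /= IH -natr1; field.
under eq_bigr do rewrite inner.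
have outer (a b c : C) M : \sum_(k < M) (a * k%:R ^+ 2 - b * k%:R + c)
    = a * (M%:R * (M%:R - 1) * (2 * M%:R - 1) / 6) - b * (M%:R * (M%:R - 1) / 2) + M%:R * c.
  elim: M => [|M IH]; first by rewrite big_ord0; field.
  by rewrite big_ord_recr /= IH -natr1; field.
by rewrite outer; field.
Qed.

Lemma normX_sub1_le (z eta : C) (n : nat) : `|z| = 1 -> `|z - 1| <= eta ->
  `|z ^+ n - 1| <= n%:R * eta.
Proof.
move=> z1 hz; rewrite subrX1 normrM mulrC ler_pM // (le_trans (ler_norm_sum _ _ _)) //.
rewrite (eq_bigr (fun=> 1)) ?sumr_const ?card_ord // => i _.
by rewrite normrX z1 expr1n.
Qed.

Lemma normX_subX_le (z eta : C) (k l : nat) : `|z| = 1 -> `|z - 1| <= eta ->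
  `|z ^+ k - z ^+ l| ^+ 2 <= (k%:R - l%:R) ^+ 2 * eta ^+ 2.
Proof.
move=> z1 hz; wlog lk : k l / (l <= k)%N => [H|].
  case/orP: (leq_total l k) => h; first exact: H.
  by rewrite distrC -[X in _ <= X * _]sqrrN opprB H.
rewrite -exprMn -natrB // ler_pXn2r ?nnegrE ?mulr_ge0 ?(le_trans _ hz) //.
rewrite -{1}(subnK lk) exprD -[X in _ - X]mul1r -mulrBl normrM normrX z1 expr1n mulr1.
exact: normX_sub1_le.
Qed.

(** Twice the square is the sum over pairs of
    [z^k conj(z)^l + z^l conj(z)^k = 2 - |z^k - z^l|^2], and
    [|z^k - z^l| <= |k - l| eta]. *)
Lemma fejer_lower_bound (z eta : C) (N : nat) : `|z| = 1 -> `|z - 1| <= eta ->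
  N%:R ^+ 2 * (1 - eta ^+ 2 * (N%:R ^+ 2 - 1) / 12)
    <= `|\sum_(k < N) z ^+ k| ^+ 2.
Proof.
move=> z1 hz; have zz : z * z^* = 1 by rewrite -normCK z1 expr1n.
have hX k : z ^+ k * z^* ^+ k = 1 by rewrite -exprMn zz expr1n.
rewrite -(ler_pM2l (_ : 0 < 2)) // normCK rmorph_sum /=.
have -> : 2 * ((\sum_(k < N) z ^+ k) * (\sum_(i < N) (z ^+ i)^*)) =
   \sum_(k < N) \sum_(l < N) (2 - `|z ^+ k - z ^+ l| ^+ 2).
  rewrite mulr_natl mulr2n {2}mulrC.
  rewrite mulr_suml [X in _ + X]mulr_suml -big_split; apply: eq_bigr => k _ /=.
  rewrite !mulr_sumr -big_split; apply: eq_bigr => l _ /=.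
  rewrite normCK rmorphB /= !rmorphXn /=.
  have -> : (z ^+ k - z ^+ l) * (z^* ^+ k - z^* ^+ l) = z ^+ k * z^* ^+ k
    + z ^+ l * z^* ^+ l - z ^+ k * z^* ^+ l - z^* ^+ k * z ^+ l by ring.
  by rewrite !hX; ring.
apply: (@le_trans _ _ (\sum_(k < N) \sum_(l < N) (2 - (k%:R - l%:R) ^+ 2 * eta ^+ 2))); last first.
  by do 2 (apply: ler_sum => ? _); rewrite lerD2l lerN2 normX_subX_le.
under [leRHS]eq_bigr do rewrite sumrB -mulr_suml sumr_const card_ord.
rewrite sumrB -mulr_suml sum_square_differences sumr_const card_ord.
rewrite le_eqVlt; apply/orP; left; apply/eqP.
by rewrite -mulrnA -[2 *+ _]mulr_natr natrM; field.
Qed.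
End Fejer.

(** * Dirichlet characters on short arcs *)

Section Characters.
Variables (R : realType) (D : nat) (chi : int -> R[i]).
Hypotheses (D0 : (0 < D)%N) (hchi : is_dirichlet_character D chi).

Lemma dchar1 : chi 1 = 1.
Proof.
have n0 : chi 1 != 0 by apply/(dchar_supp hchi); rewrite /coprimez gcd1z.
by apply: (mulfI n0); rewrite -(dchar_mul hchi) !mulr1.
Qed.

Lemma dchar_periodic_mul (n : int) (k : nat) : chi (n + (D * k)%N%:Z) = chi n.
Proof.
elim: k => [|k IH]; first by rewrite muln0 addr0.
by rewrite mulnS addnC PoszD addrA (dchar_periodic hchi).
Qed.

Lemma dchar_modn (m : nat) : chi (m %% D)%N%:Z = chi m%:Z.
Proof. by rewrite [in RHS](divn_eq m D) addnC mulnC PoszD dchar_periodic_mul. Qed.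

Lemma coprimez_nat (m : nat) : coprimez m%:Z D%:Z = coprime m D.
Proof. by []. Qed.

Lemma dchar_eq0 (m : nat) : (chi m%:Z == 0) = ~~ coprime m D.
Proof.
apply/idP/idP => [|h]; last first.
  by apply: contraNT h => /(dchar_supp hchi); rewrite coprimez_nat.
by apply: contraL => h; apply/(dchar_supp hchi).
Qed.

Lemma dchar_expn (m k : nat) : chi (m ^ k)%N%:Z = chi m%:Z ^+ k.
Proof.
elim: k => [|k IH]; first by rewrite expn0 dchar1.
by rewrite expnS PoszM (dchar_mul hchi) IH exprS.
Qed.

Lemma dchar_totient (m : nat) : coprime m D -> chi m%:Z ^+ totient D = 1.
Proof.
move=> cm; rewrite -dchar_expn -dchar_modn (Euler_exp_totient cm) dchar_modn.
exact: dchar1.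
Qed.

Lemma dchar_norm (m : nat) : coprime m D -> `|chi m%:Z| = 1.
Proof.
move=> cm; apply/eqP; rewrite -(@eqrXn2 _ (totient D)) ?totient_gt0 //.
by rewrite -normrX dchar_totient // normr1 expr1n.
Qed.

(** Values at natural numbers suffice, as every integer is congruent to one. *)
Lemma dchar_exp_principalP (k : nat) : (0 < k)%N ->
  (forall m : nat, coprime m D -> chi m%:Z ^+ k = 1) ->
  dchar_exp chi k = principal_character R D.
Proof.
move=> k0 h; apply/funext => n; rewrite /dchar_exp /principal_character.
have Dn0 : D%:Z != 0 by rewrite eqz_nat -lt0n.
have [m e] : exists m : nat, n + (D * absz n)%N%:Z = m%:Z.
  exists (absz (n + (D * absz n)%N%:Z)); rewrite gez0_abs //.
  by nia.
have e1 : chi n = chi m%:Z by rewrite -e dchar_periodic_mul.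
have e2 : coprimez n D%:Z = coprime m D.
  rewrite -coprimez_nat -e /coprimez gcdzC [in RHS]gcdzC.
  by rewrite PoszM [X in n + X]mulrC [n + _]addrC gcdzMDl.
rewrite e1 e2; case: (boolP (coprime m D)) => [/h //|].
by rewrite -dchar_eq0 => /eqP ->; rewrite expr0n gtn_eqF.
Qed.

Lemma dchar_order_exists : exists r, is_dchar_order D chi r.
Proof.
pose P k := (0 < k)%N && `[< dchar_exp chi k = principal_character R D >].
have exP : exists k, P k.
  exists (totient D); rewrite /P totient_gt0 D0; apply/asboolP.
  by apply: dchar_exp_principalP; [rewrite totient_gt0 | exact: dchar_totient].
exists (ex_minn exP); case: ex_minnP => r /andP[r0 /asboolP rP] rmin; split=> // k k0 kP.
by apply: rmin; rewrite /P k0; apply/asboolP.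
Qed.

Lemma dchar_power_nontrivial (r k : nat) : is_dchar_order D chi r ->
  (0 < k < r)%N -> exists2 b : nat, coprime b D & chi b%:Z ^+ k != 1.
Proof.
case=> r0 _ rmin /andP[k0 kr].
apply: contrapT => h; suff /(rmin k k0) : dchar_exp chi k = principal_character R D.
  by rewrite leqNgt kr.
apply: dchar_exp_principalP => // m cm; apply: contrapT => /eqP nm.
by apply: h; exists m.
Qed.

(** Multiplication by a class [b] with [chi(b)^k != 1] permutes the invertible
    classes and multiplies the sum by [chi(b)^k]. *)
Lemma sum_dchar_power (r k : nat) : is_dchar_order D chi r ->
  (0 < k < r)%N -> \sum_(a < D | coprime a D) chi (a : nat)%:Z ^+ k = 0.
Proof.
move=> hr hk; have [b cb nb] := dchar_power_nontrivial hr hk.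
pose f (a : 'I_D) : 'I_D := Ordinal (ltn_pmod (b * a) D0).
have cf a : coprime (f a) D = coprime a D by rewrite /= coprime_modl coprimeMl cb.
have fI : injective f.
  suff h (i j : 'I_D) : (i <= j)%N -> f i = f j -> i = j.
    by move=> i j e; case/orP: (leq_total i j) => /h ->.
  move=> ij [] /eqP; rewrite eq_sym eqn_mod_dvd ?leq_mul2l ?ij ?orbT //.
  rewrite -mulnBr Gauss_dvdr 1?coprime_sym // => dv; apply/val_inj/eqP; rewrite eqn_leq ij /=.
  rewrite leqNgt -subn_gt0; apply/negP => pos.
  have := dvdn_leq pos dv; rewrite leqNgt; move/negP; apply.
  by rewrite (leq_ltn_trans (leq_subr _ _)).
set s := \sum_(a < D | _) _.
have e : s = chi b%:Z ^+ k * s.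
  rewrite {1}/s (reindex_inj fI) /= mulr_sumr.
  rewrite (eq_bigl (fun a : 'I_D => coprime a D)) => [|a]; last exact: cf.
  by apply: eq_bigr => a _; rewrite dchar_modn PoszM (dchar_mul hchi) exprMn.
apply/eqP; have : (1 - chi b%:Z ^+ k) * s == 0 by rewrite mulrBl mul1r -e subrr.
by rewrite mulf_eq0 subr_eq0 eq_sym (negPf nb).
Qed.

Lemma sum_coprime : \sum_(a < D | coprime a D) 1 = (totient D)%:R :> R[i].
Proof.
rewrite totient_count_coprime big_mkord natr_sum big_mkcond.
by apply: eq_bigr => a _; rewrite coprime_sym; case: coprime.
Qed.

(** Only the diagonal survives when the square is expanded, by orthogonality
    of the powers of [chi] below its order. *)
Lemma dchar_fejer_sum (r N : nat) (w : R[i]) : is_dchar_order D chi r ->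
  (N <= r)%N -> `|w| = 1 ->
  \sum_(a < D | coprime a D) `|\sum_(k < N) (chi (a : nat)%:Z * w) ^+ k| ^+ 2
    = N%:R * (totient D)%:R.
Proof.
move=> hr Nr w1.
have off (k l : nat) : (l < k < N)%N ->
   \sum_(a < D | coprime a D) (chi (a : nat)%:Z * w) ^+ k * ((chi (a : nat)%:Z * w) ^+ l)^*%R = 0.
  move=> /andP[lk kN].
  rewrite (eq_bigr (fun a : 'I_D => w ^+ (k - l) * chi (a : nat)%:Z ^+ (k - l))).
    rewrite -mulr_sumr (@sum_dchar_power r) ?mulr0 // subn_gt0 lk.
    by rewrite (leq_ltn_trans (leq_subr _ _)) // (leq_trans kN).
  move=> a ca; rewrite -{1}(subnK (ltnW lk)) exprD -mulrA -normCK normrX normrM.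
  by rewrite dchar_norm // w1 mulr1 !expr1n mulr1 mulrC exprMn.
transitivity (\sum_(k < N) \sum_(l < N) \sum_(a < D | coprime a D)
   (chi (a : nat)%:Z * w) ^+ k * ((chi (a : nat)%:Z * w) ^+ l)^*%R).
  rewrite [RHS](eq_bigr (fun k : 'I_N => \sum_(a < D | coprime a D) \sum_(l < N)
     (chi (a : nat)%:Z * w) ^+ k * ((chi (a : nat)%:Z * w) ^+ l)^*%R)); last first.
    by move=> k _; rewrite exchange_big.
  rewrite exchange_big /=; apply: eq_bigr => a ca; rewrite normCK rmorph_sum mulr_suml.
  by apply: eq_bigr => k _; rewrite mulr_sumr.
rewrite (eq_bigr (fun=> (totient D)%:R)); last first.
  move=> k _; rewrite (bigD1 k) //= [X in _ + X]big1 => [|l nlk].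
    rewrite addr0 -sum_coprime; apply: eq_bigr => a ca.
    by rewrite -normCK normrX normrM dchar_norm // w1 mulr1 !expr1n.
  case: (ltngtP l k) => lk; first by rewrite off // lk ltn_ord.
    rewrite -[LHS]conjCK rmorph_sum /= (eq_bigr (fun a : 'I_D =>
      (chi (a : nat)%:Z * w) ^+ l * ((chi (a : nat)%:Z * w) ^+ k)^*%R)).
      by rewrite off ?rmorph0 // lk ltn_ord.
    by move=> a _; rewrite rmorphM /= conjCK mulrC.
  by rewrite (val_inj lk) eqxx in nlk.
by rewrite sumr_const card_ord [RHS]mulr_natl.
Qed.

Lemma normCE (z : R[i]) : `|z| = (ComplexField.Normc.normc z)%:C%C.
Proof. by []. Qed.

(** The kernel of length [N = floor (2 / eta) <= r] has average [N] over the
    classes, and is at least [N^2 q] with [q = 1 - eta^2 (N^2 - 1) / 12] on the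
    arc; hence the count is at most [phi(D) / (N q)]. *)
Lemma dchar_arc_count (r : nat) (w : R[i]) (eta : R) :
  is_dchar_order D chi r -> 2 / eta <= r%:R -> 0 < eta -> eta <= 1 -> `|w| = 1 ->
  (#|[set a : 'I_D | coprime a D &&
       (ComplexField.Normc.normc (chi (a : nat)%:Z * w - 1) <= eta)]|)%:R
    <= 27 / 32 * eta * (totient D)%:R.
Proof.
move=> hr rge eta0 eta1 w1; set A := [set _ | _].
have pos : 0 <= 2 / eta by rewrite divr_ge0 // ltW.
pose N := Num.truncn (2 / eta).
have /andP[Nle Ngt] := truncn_itv pos; rewrite -/N in Nle Ngt.
have Nr : (N <= r)%N by rewrite -(ler_nat R) (le_trans Nle).
have N2 : (2 <= N)%N.
  rewrite -ltnS -(ltr_nat R) (le_lt_trans _ Ngt) // ler_pdivlMr //.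
  by rewrite ler_piMr.
pose q : R := 1 - eta ^+ 2 * (N%:R ^+ 2 - 1) / 12.
have h1 : (#|A|)%:R * (N%:R ^+ 2 * q) <= N%:R * (totient D)%:R.
  rewrite -lecR [leRHS]rmorphM /= !rmorph_nat -(dchar_fejer_sum hr Nr w1).
  rewrite rmorphM /= rmorph_nat -sum1_card natr_sum mulr_suml.
  rewrite [leLHS]big_mkcond [leRHS]big_mkcond /=; apply: ler_sum => a _.
  rewrite mul1r inE; case: (boolP (coprime a D)) => //= ca.
  case: ifP => [ha|_]; last exact: exprn_ge0.
  have := @fejer_lower_bound _ (chi (a : nat)%:Z * w) eta%:C%C N.
  rewrite normrM dchar_norm // w1 mulr1 normCE lecR => /(_ erefl ha); apply: le_trans.
  rewrite le_eqVlt; apply/orP; left; apply/eqP; rewrite /q.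
  by rewrite !(rmorphM, rmorphB, rmorphXn, rmorph_nat, rmorph1, fmorphV).
have Np : 0 < N%:R :> R by rewrite ltr0n (leq_trans _ N2).
(* With [s = N eta], [q = 1 - (s^2 - eta^2) / 12] and [2 - s < eta <= s / 2], so
   that [s > 4/3] and [s q >= s (4 - s) / 3]; the latter equals [32/27] at
   [s = 4/3] and at [s = 8/3], so is larger in between. *)
have key : 32 / 27 <= eta * N%:R * q.
  have s2 : N%:R * eta <= 2 by rewrite -ler_pdivlMr.
  have s1 : 2 < (N%:R + 1) * eta by rewrite -ltr_pdivrMr // natr1.
  have N2' : 2 <= N%:R :> R by rewrite ler_nat.
  have h s : s <= 2 -> 2 - s < eta -> 2 * eta <= s ->
      32 / 27 <= s - s * (s ^+ 2 - eta ^+ 2) / 12.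
    move=> hs2 hs1 hs3; have hs4 : 4 / 3 < s by lra.
    have hsq : (2 - s) ^+ 2 <= eta ^+ 2.
      by rewrite ler_pXn2r ?nnegrE ?subr_ge0 // ltW.
    have h3 : s * (s ^+ 2 - eta ^+ 2) <= s * (s ^+ 2 - (2 - s) ^+ 2).
      by rewrite ler_wpM2l ?lerD2l ?lerN2 //; lra.
    have h4 : 0 <= (s - 4 / 3) * (8 / 3 - s) by rewrite mulr_ge0; lra.
    by move: h3 h4; rewrite !expr2; lra.
  rewrite (_ : eta * N%:R * q = N%:R * eta - N%:R * eta *
    ((N%:R * eta) ^+ 2 - eta ^+ 2) / 12); last by rewrite /q; ring.
  apply: h => //; first by lra.
  by rewrite ler_wpM2r // ltW.
have h2 : (#|A|)%:R * (N%:R * q) <= (totient D)%:R.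
  by rewrite -(ler_pM2l Np) (le_trans _ h1) // le_eqVlt; apply/orP; left; apply/eqP; ring.
have h3 : (#|A|)%:R * (32 / 27) <= eta * (totient D)%:R.
  apply: le_trans (ler_wpM2l (ler0n _ _) key) _.
  apply: le_trans (ler_wpM2l (ltW eta0) h2); rewrite le_eqVlt; apply/orP; left; apply/eqP; ring.
by rewrite -mulrA; lra.
Qed.

End Characters.

(** * The twist by p^(it) *)

Section Twist.
Variable R : realType.
Local Notation normc := ComplexField.Normc.normc.

Lemma norm_sin_le (x : R) : `|sin x| <= `|x|.
Proof.
wlog x0 : x / 0 < x => [H|].
  case: (ltgtP x 0) => [xn|xp|->]; [|exact: H|by rewrite sin0].
  by rewrite -normrN -sinN -(normrN x) H // oppr_gt0.
have [|c _] := MVT x0 (fun y _ => is_derive_sin y).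
  exact/continuous_subspaceT/continuous_sin.
rewrite sin0 !subr0 => ->; rewrite normrM ler_piMl //; exact: cos_max.
Qed.

Lemma one_sub_cos_le (x : R) : 2 * (1 - cos x) <= x ^+ 2.
Proof.
have -> : cos x = 1 - 2 * sin (x / 2) ^+ 2.
  have e : x = (x / 2) *+ 2 by rewrite -mulr_natr; field.
  by rewrite {1}e cos_mulr2n cos2sin2 -mulr_natr; ring.
have : sin (x / 2) ^+ 2 <= (x / 2) ^+ 2.
  rewrite -[leLHS]real_normK ?num_real // -[leRHS]real_normK ?num_real //.
  by rewrite ler_pXn2r ?nnegrE ?norm_sin_le.
by rewrite expr_div_n; lra.
Qed.

Lemma normc_natpow_it (n : nat) (t : R) : normc (natpow_it n t) = 1.
Proof. by rewrite /natpow_it /= cos2Dsin2 sqrtr1. Qed.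

Lemma natpow_it_sub_le (m n : nat) (t : R) :
  normc (natpow_it m t - natpow_it n t) <= `|t| * `|ln m%:R - ln n%:R|.
Proof.
rewrite /natpow_it /= -normrM mulrBr -sqrtr_sqr ler_sqrt ?sqr_ge0 //.
move: (t * ln m%:R) (t * ln n%:R) => a b; apply: le_trans (one_sub_cos_le _).
rewrite cosB; have := cos2Dsin2 a; have := cos2Dsin2 b.
rewrite !expr2; nra.
Qed.
End Twist.

(** * Near primes in a block and in a scale *)

Lemma sum_residue_classes (V : nmodType) (F : nat -> V) (d H : nat) :
  \sum_(v < d * H) F v = \sum_(a < d) \sum_(m < H) F (a + d * m)%N.
Proof.
rewrite exchange_big /=; elim: H => [|H IH].
  by rewrite big_ord0; move: (muln0 d) => e; rewrite -(big_mkord predT F) e big_geq.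
rewrite big_ord_recr /= -IH -!(big_mkord predT F) mulnS addnC.
rewrite (@big_cat_nat _ _ _ (d * H)) ?leq_addr //=; congr (_ + _).
rewrite -{1}(add0n (d * H)%N) big_addn addKn big_mkord.
by apply: eq_bigr.
Qed.

Lemma sum_blocks (V : nmodType) (F : nat -> V) (P : pred nat) (c a b : nat) : (a <= b)%N ->
  \sum_(a <= u < b) \sum_(c * u <= p < c * u.+1 | P p) F p = \sum_(c * a <= p < c * b | P p) F p.
Proof.
move=> ab; rewrite -(subnKC ab); elim: (b - a)%N => [|k IH].
  by rewrite addn0 !big_geq.
rewrite addnS big_nat_recr ?leq_addr //= IH.
by rewrite -big_cat_nat // leq_mul2l ?leq_addr ?leqnSn orbT.
Qed.

Lemma ler_sum_nat_cond (R : numDomainType) (a b a' b' : nat) (P Q : pred nat) (f : nat -> R) :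
  (forall p, 0 <= f p) -> (a' <= a)%N -> (b <= b')%N -> (forall p, P p -> Q p) ->
  \sum_(a <= p < b | P p) f p <= \sum_(a' <= p < b' | Q p) f p.
Proof.
move=> f0 aa bb PQ; case: (leqP a b) => [ab|/ltnW ba]; last first.
  by rewrite big_geq // sumr_ge0.
rewrite (@big_cat_nat _ _ _ a a' b') ?(leq_trans ab) //= (@big_cat_nat _ _ _ b a b') //=.
rewrite -[leLHS]add0r lerD ?sumr_ge0 // -[leLHS]addr0 lerD ?sumr_ge0 //.
rewrite big_mkcond [leRHS]big_mkcond; apply: ler_sum => p _.
by case: ifP => [/PQ -> //|_]; case: ifP.
Qed.

Lemma ln2_bounds (R : realType) : 1 / 2 <= (ln 2 : R) <= 1.
Proof.
apply/andP; split.
  by have := inv_natS_le R (n := 1%N) isT; rewrite ln1 subr0; lra.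
by have := ln_natS_sub_le R (n := 1%N) isT; rewrite ln1 subr0 invr1.
Qed.

Section Blocks.
Variables (R : realType) (D : nat) (chi : int -> R[i]).
Local Notation normc := ComplexField.Normc.normc.
Hypotheses (D2 : (2 <= D)%N) (hchi : is_dirichlet_character D chi).
Let D0 : (0 < D)%N := ltnW D2.

(** The scale [i] is [[32^i D U, 32^(i+1) D U)], and is cut into blocks of length
    [D 32^i].  A block is short, by a factor [U] at least, compared with its
    elements; so by [tU] the phase of [p^(it)] varies over it by at most
    [eta / 16]. *)
Variables (r : nat) (eta t : R) (U : nat).
Hypotheses (hr : is_dchar_order D chi r) (rge : 2 / eta <= r%:R).
Hypotheses (eta0 : 0 < eta) (eta1 : eta <= 1).
Hypotheses (U16 : (16 <= U)%N) (tU : `|t| / U%:R <= eta / 16).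

Definition near_one (p : nat) : bool :=
  normc (1 - chi p%:Z * natpow_it p t) <= 15 / 16 * eta.

(** The classes of the near primes lie on the arc of [dchar_arc_count] for
    [w = y^(it)], where [y] is the start of the block, and each class is
    sifted separately. *)
Lemma block_bound (i u : nat) : (0 < i)%N -> (U <= u)%N ->
  \sum_(D * 32 ^ i * u <= p < D * 32 ^ i * u.+1 | prime p && near_one p) (p%:R^-1 : R)
    <= 27 / 32 * eta * (((2 * i)%:R * ln 2)^-1 + (2 ^+ i)^-1) * u%:R^-1.
Proof.
move=> i0 Uu; set H := (32 ^ i)%N; set y := (D * H * u)%N.
have u0 : (0 < u)%N by rewrite (leq_trans _ Uu) // (leq_trans _ U16).
have H0 : (0 < H)%N by rewrite expn_gt0.
have y0 : (0 < y)%N by rewrite !muln_gt0 D0 H0 u0.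
have yD : (D < y)%N.
  rewrite /y -mulnA ltn_Pmulr //.
  by rewrite (leq_trans (leq_trans (isT : (1 < 16)%N) (leq_trans U16 Uu))) // leq_pmull.
have yp : 0 < y%:R :> R by rewrite ltr0n.
pose w := natpow_it y t.
have w1 : `|w| = 1 by rewrite normCE normc_natpow_it.
pose A := [set a : 'I_D | coprime a D && (normc (chi (a : nat)%:Z * w - 1) <= eta)].
have hA (a : 'I_D) (m : nat) : (m < H)%N ->
   prime (y + (a + D * m)) -> near_one (y + (a + D * m)) -> a \in A.
  move=> mH; set p := (y + (a + D * m))%N => pp near.
  have yp' : (y <= p)%N by rewrite leq_addr.
  have cpD : coprime p D.
    rewrite prime_coprime //; apply/negP => /(dvdn_leq D0).
    by rewrite leqNgt (leq_trans yD).
  have pa : chi p%:Z = chi (a : nat)%:Z.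
    have -> : p = (a + D * (H * u + m))%N by rewrite /p /y mulnDr; lia.
    by rewrite PoszD dchar_periodic_mul.
  have ca : coprime a D.
    by apply: contraLR cpD; rewrite -!(dchar_eq0 hchi) pa.
  rewrite inE ca /=.
  have -> : chi (a : nat)%:Z * w - 1 = - (1 - chi p%:Z * natpow_it p t)
       + chi (a : nat)%:Z * (w - natpow_it p t) by rewrite pa; ring.
  rewrite (le_trans (le_normcD _ _)) // normcN.
  rewrite (ComplexField.Normc.normcM (chi _)).
  have -> : normc (chi (a : nat)%:Z) = 1.
    by have := dchar_norm D0 hchi ca; rewrite normCE => /(congr1 (@complex.Re R)).
  rewrite mul1r.
  have hw : normc (w - natpow_it p t) <= eta / 16.
    apply: (le_trans (natpow_it_sub_le _ _ _)).
    apply: le_trans tU; rewrite ler_wpM2l // distrC ger0_norm; last first.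
      by rewrite subr_ge0 ler_ln ?posrE ?ltr0n ?(leq_trans y0) // ler_nat.
    rewrite -ln_div ?posrE ?ltr0n ?(leq_trans y0) //.
    have e : p%:R / y%:R = 1 + (a + D * m)%N%:R / y%:R :> R.
      by rewrite /p natrD mulrDl divff ?gt_eqF.
    have q0 : 0 <= (a + D * m)%N%:R / y%:R :> R by rewrite divr_ge0.
    rewrite e (le_trans (le_ln1Dx _)) ?(lt_le_trans _ q0) ?ltrN10 //.
    rewrite ler_pdivrMr // mulrC ler_pdivlMr ?ltr0n ?(leq_trans _ U16) //.
    rewrite -natrM ler_nat /y (leq_trans (leq_mul (leqnn _) Uu)) //.
    rewrite leq_mul2r; apply/orP; right.
    have h : (a + D * m < D * m.+1)%N by rewrite mulnS ltn_add2r.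
    by rewrite (leq_trans (ltnW h)) // leq_mul2l mH orbT.
  by move: near hw; rewrite /near_one; lra.
apply: (@le_trans _ _ (y%:R^-1 * \sum_(a < D) \sum_(m < H)
     ((a \in A) && prime (y + a + D * m))%:R)).
  have -> : (D * H * u.+1 = y + D * H)%N by rewrite mulnS addnC.
  rewrite -{1}(add0n y) big_addn addKn big_mkcond big_mkord mulr_sumr.
  rewrite (@sum_residue_classes _ (fun v =>
    if prime (v + y) && near_one (v + y) then (v + y)%:R^-1 else 0)).
  apply: ler_sum => a _; rewrite mulr_sumr; apply: ler_sum => m _.
  rewrite addnC; case: ifP => [/andP[pp near]|_]; last by rewrite mulr_ge0 ?invr_ge0.
  rewrite (hA a m) // -addnA pp mulr1 lef_pV2 ?posrE ?ltr0n ?addn_gt0 ?y0 //.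
  by rewrite ler_nat leq_addr.
have lz : 0 < ln 2 :> R by rewrite ln_gt0 // ltr1n.
have ip : 0 < i%:R :> R by rewrite ltr0n.
have tot0 : 0 < (totient D)%:R :> R by rewrite ltr0n totient_gt0.
have Dp : 0 < D%:R :> R by rewrite ltr0n.
have Hp : 0 < H%:R :> R by rewrite ltr0n.
have up : 0 < u%:R :> R by rewrite ltr0n.
pose K : R := H%:R * D%:R / ((totient D)%:R * ln (4 ^ i)%N%:R) + (4 ^ i)%N%:R ^+ 2.
have hK (a : nat) : \sum_(m < H) (prime (y + a + D * m))%:R <= K.
  have z1 : (1 < 4 ^ i)%N by rewrite -[1%N](expn0 4) ltn_exp2l.
  have zN : (4 ^ i < y + a)%N.
    rewrite (leq_trans _ (leq_addr _ _)) // /y mulnAC.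
    rewrite (@leq_ltn_trans H) ?leq_exp2r // -{1}[H]mul1n ltn_mul2r H0 /=.
    by rewrite (leq_trans D2) // leq_pmulr.
  have := @brun_titchmarsh_progression R D (4 ^ i) (y + a) H D0 z1 zN.
  apply: le_trans; rewrite -sum1_card natr_sum [leRHS]big_mkcond /=.
  by apply: ler_sum => m _; rewrite inE; case: prime.
have K0 : 0 <= K by rewrite (le_trans _ (hK 0%N)) // sumr_ge0.
have hcount : \sum_(a < D) \sum_(m < H) ((a \in A) && prime (y + a + D * m))%:R
    <= (#|A|)%:R * K.
  rewrite -sum1_card natr_sum mulr_suml [leRHS]big_mkcond.
  apply: ler_sum => a _; case: ifP => aA; last by rewrite big1.
  by rewrite mul1r; apply: hK.
have := dchar_arc_count D0 hchi hr rge eta0 eta1 w1; rewrite -/A => hAc.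
have tD : (totient D)%:R <= D%:R :> R.
  rewrite ler_nat totient_count_coprime big_mkord.
  rewrite -[leqRHS]card_ord -sum1_card leq_sum // => a _.
  exact: leq_b1.
apply: (@le_trans _ _ (y%:R^-1 * (27 / 32 * eta * (totient D)%:R * K))).
  by rewrite ler_wpM2l ?invr_ge0 // (le_trans hcount) // ler_wpM2r.
have e4 : ln (4 ^ i)%N%:R = (2 * i)%:R * ln 2 :> R.
  by rewrite -[4%N]/(2 ^ 2)%N -expnM ln_pow2.
have eH : H%:R = (4 ^ i)%N%:R ^+ 2 * 2 ^+ i :> R.
  by rewrite -!natrX -natrM expnAC -expnMn.
have fp : 0 < (4 ^ i)%N%:R :> R by rewrite ltr0n expn_gt0.
have tp : 0 < 2 ^+ i :> R by rewrite exprn_gt0.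
have -> : y%:R^-1 * (27 / 32 * eta * (totient D)%:R * K) = 27 / 32 * eta *
   (((2 * i)%:R * ln 2)^-1 + (2 ^+ i)^-1 * ((totient D)%:R / D%:R)) * u%:R^-1.
  rewrite /K e4 /y !natrM eH; field.
  by rewrite !gt_eqF.
rewrite ler_wpM2r ?invr_ge0 // ler_wpM2l ?mulr_ge0 ?(ltW eta0) // lerD2l.
by rewrite ler_piMr ?invr_ge0 ?(ltW tp) // ler_pdivrMr // mul1r.
Qed.

(** The sum of [1/u] over [[U, 32 U)] is about [ln 32 = 5 ln 2], which cancels
    the [ln 2] of the sieve; [11/5] exceeds [(27/32) (5/2)] by enough to absorb
    the error [1/U]. *)
Lemma scale_bound (i : nat) : (0 < i)%N ->
  \sum_(32 ^ i * D * U <= p < 32 ^ i.+1 * D * U | prime p && near_one p) (p%:R^-1 : R)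
    <= eta * (11 / 5 * i%:R^-1 + 5 * (2 ^+ i)^-1).
Proof.
move=> i0; have U0 : (0 < U)%N by rewrite (leq_trans _ U16).
have eL : (32 ^ i * D * U = D * 32 ^ i * U)%N by rewrite [(D * _)%N]mulnC.
have eR : (32 ^ i.+1 * D * U = D * 32 ^ i * (32 * U))%N by rewrite expnS; lia.
rewrite eL eR -sum_blocks ?leq_pmull //.
set c := 27 / 32 * eta * (((2 * i)%:R * ln 2)^-1 + (2 ^+ i)^-1).
apply: (@le_trans _ _ (\sum_(U <= u < 32 * U) c * u%:R^-1)).
  rewrite big_nat_cond [leRHS]big_nat_cond; apply: ler_sum => u /andP[/andP[Uu _] _].
  exact: block_bound.
have /andP[l1 l2] := ln2_bounds R.
have lp : 0 < ln 2 :> R by lra.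
have ip : 0 < i%:R :> R by rewrite ltr0n.
have tp : 0 < (2 ^+ i)^-1 :> R by rewrite invr_gt0 exprn_gt0.
have c0 : 0 <= c.
  rewrite /c mulr_ge0 ?mulr_ge0 ?(ltW eta0) // addr_ge0 ?(ltW tp) // invr_ge0.
  by rewrite mulr_ge0 // ltW.
have hU : \sum_(U <= u < 32 * U) (u%:R^-1 : R) <= 16^-1 + 5 * ln 2.
  apply: (le_trans (sum_inv_le_ln R U0 _)); first by rewrite leq_pmull.
  rewrite natrM lnM ?posrE ?ltr0n // addrK.
  have -> : ln 32 = 5 * ln 2 :> R by rewrite -[32]/((2 ^ 5)%N%:R) ln_pow2.
  by rewrite lerD2r lef_pV2 ?posrE ?ltr0n // ler_nat.
rewrite -mulr_sumr (le_trans (ler_wpM2l c0 hU)) // /c.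
have -> : 27 / 32 * eta * (((2 * i)%:R * ln 2)^-1 + (2 ^+ i)^-1) * (16^-1 + 5 * ln 2)
  = eta * (27 / 32 * ((16^-1 + 5 * ln 2) / (2 * ln 2)) * i%:R^-1
           + 27 / 32 * (16^-1 + 5 * ln 2) * (2 ^+ i)^-1).
  by rewrite natrM; field; rewrite !gt_eqF ?exprn_gt0.
rewrite ler_wpM2l ?(ltW eta0) // lerD // ler_wpM2r ?invr_ge0 ?(ltW tp) //.
  have h : (16^-1 + 5 * ln 2) / (2 * ln 2) <= 41 / 16 :> R.
    by rewrite ler_pdivrMr ?mulr_gt0 //; lra.
  lra.
lra.
Qed.

(** The first scale.  As [32^i0] exceeds [D], the sum of [1/i] from [i0] on is
    compared with primes beyond [D]; as [i0] is only [O(ln D)], the primes from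
    [D] to [32^i0 D U] have bounded total reciprocal. *)
Let i0 := (trunc_log 2 D).+1.

Lemma near_one_sum_le (N : nat) :
  \sum_(D.+1 <= p < N.+1 | prime p && near_one p) (p%:R^-1 : R)
    <= \sum_(D.+1 <= p < 32 ^ i0 * D * U | prime p) (p%:R^-1 : R)
       + eta * (11 / 5 * (\sum_(D.+1 <= p < N.+1 | prime p) p%:R^-1
                          + harmonic_defect R) + 5).
Proof.
have inv0 (p : nat) : 0 <= p%:R^-1 :> R by rewrite invr_ge0.
have U0 : (0 < U)%N by rewrite (leq_trans _ U16).
have Di0 : (D <= 32 ^ i0)%N.
  by rewrite (leq_trans (ltnW (trunc_log_ltn D (isT : (1 < 2)%N)))) // leq_exp2r.
have DU : (32 <= D * U)%N by rewrite -[32%N]/(2 * 16)%N leq_mul.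
(* The scales [i0 + i] with [i < n] cover everything up to [N], but their
   counterparts [(32^i, 32^(i+1)]] in the Mertens comparison stay below [N]. *)
have [n hn Nn] : exists2 n, n = 0%N \/ (32 ^ (i0 + n) <= N)%N & (N < 32 ^ (i0 + n) * D * U)%N.
  case: (ltnP N (32 ^ i0)) => [lt|le].
    exists 0%N; first by left.
    by rewrite addn0 (leq_trans lt) // -mulnA leq_pmulr // muln_gt0 D0.
  have N0 : (0 < N)%N by rewrite (leq_trans _ le) // expn_gt0.
  have i0le : (i0 <= trunc_log 32 N)%N by rewrite trunc_log_max.
  exists (trunc_log 32 N - i0)%N; rewrite subnKC //.
    by right; rewrite trunc_logP.
  rewrite (leq_trans (trunc_log_ltn N (isT : (1 < 32)%N))) // expnSr -mulnA.
  by rewrite leq_mul2l DU orbT.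
have hscales m :
   \sum_(32 ^ i0 * D * U <= p < 32 ^ (i0 + m) * D * U | prime p && near_one p)
     (p%:R^-1 : R)
   <= eta * (11 / 5 * \sum_(i < m) (i0 + i)%:R^-1 + 5 * \sum_(i < m) (2 ^+ (i0 + i))^-1).
  elim: m => [|m IH]; first by rewrite addn0 big_geq // !big_ord0 !mulr0 addr0 mulr0.
  rewrite (@big_cat_nat _ _ _ (32 ^ (i0 + m) * D * U)) //=; last 2 first.
  - by rewrite -!mulnA leq_mul2r leq_exp2l // leq_addr orbT.
  - by rewrite -!mulnA leq_mul2r leq_exp2l // leq_add2l leqnSn orbT.
  rewrite !big_ord_recr /= addnS.
  have h : (0 < i0 + m)%N by rewrite addn_gt0.
  have := scale_bound h.
  by move: IH; rewrite !mulrDr; lra.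
have geo m : \sum_(i < m) (2 ^+ (i0 + i))^-1 <= 1 :> R.
  suff h : \sum_(i < m) (2 ^+ (i0 + i))^-1 <= 1 - (2 ^+ m)^-1 :> R.
    by rewrite (le_trans h) // gerBl invr_ge0 exprn_ge0.
  elim: m => [|m IH]; first by rewrite big_ord0 expr0 invr1 subrr.
  rewrite big_ord_recr /=; have h : (2 ^+ (i0 + m))^-1 <= (2 ^+ m.+1)^-1 :> R.
    by rewrite lef_pV2 ?posrE ?exprn_gt0 // ler_eXn2l ?ltr1n // /i0 addSn ltnS leq_addl.
  have e : (2 ^+ m)^-1 = 2 * (2 ^+ m.+1)^-1 :> R.
    by rewrite exprS; field; rewrite expf_neq0.
  by move: IH h; rewrite e; lra.
have hP : \sum_((32 ^ i0).+1 <= p < (32 ^ (i0 + n)).+1 | prime p) (p%:R^-1 : R)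
    <= \sum_(D.+1 <= p < N.+1 | prime p) p%:R^-1.
  case: hn => [->|hn]; first by rewrite addn0 big_geq // sumr_ge0.
  exact: ler_sum_nat_cond.
apply: (@le_trans _ _
  (\sum_(D.+1 <= p < 32 ^ (i0 + n) * D * U | prime p && near_one p)
     (p%:R^-1 : R))).
  exact: ler_sum_nat_cond.
have le1 : (D.+1 <= 32 ^ i0 * D * U)%N.
  rewrite -mulnA (leq_trans _ (leq_mul Di0 DU)) // mulnC; lia.
rewrite (@big_cat_nat _ _ _ (32 ^ i0 * D * U)) //=; last first.
  by rewrite -!mulnA leq_mul2r leq_exp2l // leq_addr orbT.
rewrite lerD //.
  by apply: (ler_sum_nat_cond inv0) => // p /andP[].
apply: (le_trans (hscales n)); rewrite ler_wpM2l ?(ltW eta0) //.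
have h1 := geo n; have h2 := @harmonic_le_primes R i0 n isT; lra.
Qed.

End Blocks.

(** * Assembly *)

(** With [2^k <= D < 2^(k+1)], the range is inside [(2^k, 2^l]] where [l / k] is
    bounded in terms of [b]; there [1/p <= (ln p / p) / (k ln 2)], and Mertens'
    theorem applies. *)
Lemma short_range_sum_le (R : realType) (D b : nat) : (2 <= D)%N ->
  \sum_(D.+1 <= p < 32 ^ (trunc_log 2 D).+1 * D * D ^ (2 * b + 4) | prime p) (p%:R^-1 : R)
    <= 2 * (2 * b + 10)%:R + (3 + 2 * ln 2) / ln 2.
Proof.
move=> D2; have D0 := ltnW D2; set k := trunc_log 2 D.
have k0 : (0 < k)%N by rewrite /k trunc_log_max.
have kD : (2 ^ k <= D)%N by rewrite trunc_logP.
have Dk : (D <= 2 ^ k.+1)%N by rewrite ltnW // trunc_log_ltn.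
pose l := (k.+1 * (2 * b + 10))%N.
have inv0 (p : nat) : 0 <= p%:R^-1 :> R by rewrite invr_ge0.
have kl : (k <= l)%N by rewrite /l; nia.
have lp : 0 < ln 2 :> R by rewrite ln_gt0 // ltr1n.
have kp : 0 < k%:R :> R by rewrite ltr0n.
apply: (@le_trans _ _ (\sum_((2 ^ k).+1 <= p < (2 ^ l).+1 | prime p) (p%:R^-1 : R))).
  apply: ler_sum_nat_cond => //.
  rewrite leqW // -mulnA -expnS.
  rewrite [X in (_ <= X)%N](_ : _ = 32 ^ k.+1 * (2 ^ k.+1) ^ (2 * b + 4).+1)%N.
    by rewrite leq_mul2l leq_exp2r ?Dk ?orbT.
  by rewrite -[32%N]/(2 ^ 5)%N -!expnM -expnD; congr (2 ^ _)%N; rewrite /l; lia.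
apply: (le_trans (sum_inv_primes_le R k0 kl)).
have kn : 1 <= k%:R :> R by rewrite ler1n.
apply: (@le_trans _ _ ((l%:R * ln 2 + (3 + 2 * ln 2)) / (k%:R * ln 2))).
  rewrite ler_wpM2r ?invr_ge0 ?mulr_ge0 ?(ltW lp) // -addrA lerD2r ler_wpM2r ?(ltW lp) //.
  by rewrite ler_nat leq_subr.
have -> : (l%:R * ln 2 + (3 + 2 * ln 2)) / (k%:R * ln 2)
    = l%:R / k%:R + (3 + 2 * ln 2) / ln 2 / k%:R :> R.
  by field; rewrite !gt_eqF.
apply: lerD.
  rewrite ler_pdivrMr // -!natrM ler_nat /l; nia.
have c0 : 0 <= (3 + 2 * ln 2) / ln 2 :> R by rewrite divr_ge0 ?addr_ge0 ?mulr_ge0 ?(ltW lp).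
by rewrite ler_pdivrMr // ler_peMr.
Qed.

Lemma fsbig_primes_between (R : realType) (D : nat) (x : R) (S : set nat) (f : nat -> R) :
  (S `<=` primes_between D x)%classic ->
  \sum_(p \in S) f p =
    \sum_(D.+1 <= p < (Num.truncn x).+1 | prime p && `[< S p >]) f p.
Proof.
move=> hS; rewrite -[RHS]big_filter [RHS]fsbig_seq ?filter_uniq ?iota_uniq //.
set s := [seq _ <- _ | _]; suff -> : [set` s]%classic = S by [].
apply/seteqP; split => p /=; last first.
  move=> Sp; have [pp Dp px] := hS p Sp.
  rewrite mem_filter pp mem_index_iota Dp ltnS truncn_ge_nat ?(le_trans _ px) //
    ?px ?andbT /=.
  exact/asboolP.
by rewrite mem_filter => /andP[/andP[_ /asboolP]].
Qed.

Lemma primes_between_le_truncn (R : realType) (D p : nat) (x : R) :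
  (D < p < (Num.truncn x).+1)%N -> prime p -> primes_between D x p.
Proof.
by case: p => // p /andP[Dp]; rewrite ltnS truncn_gt_nat => px pp.
Qed.

(** [delta >= 8 D^(-3B)] says that [eta >= 2 D^(-B)], so a power of [D] with
    exponent [2 b + 4] separates [|t| <= D^B] from [eta / 16]. *)
Lemma cube_root_bounds (R : realType) (D b : nat) (B delta t : R) :
  (2 <= D)%N -> 0 < B -> B <= b%:R -> 8 * (D%:R `^ (- (3 * B))) <= delta ->
  `|t| <= D%:R `^ B ->
  let eta := delta `^ (1 / 3) in
  [/\ 0 < eta, delta = eta ^+ 3, delta `^ (- (1 / 3)) = eta^-1
    & `|t| / (D ^ (2 * b + 4))%N%:R <= eta / 16].
Proof.
move=> D2 B0 Bb hdelta ht eta; have Dp : 0 < D%:R :> R by rewrite ltr0n ltnW.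
set P : R := D%:R `^ B in ht *.
have P0 : 0 < P by rewrite powR_gt0.
have eP : D%:R `^ (- (3 * B)) = (P ^+ 3)^-1.
  by rewrite powRN mulrC powRrM powR_mulrn ?(ltW P0).
rewrite eP in hdelta.
have d0 : 0 < delta by rewrite (lt_le_trans _ hdelta) // mulr_gt0 // invr_gt0 exprn_gt0.
have eta0 : 0 < eta by rewrite powR_gt0.
have e3 : delta = eta ^+ 3.
  rewrite -powR_mulrn ?(ltW eta0) // -powRrM (_ : 1 / 3 * 3%:R = 1) ?powRr1 ?(ltW d0) //.
  by field.
split=> //; first by rewrite powRN.
have etaP : 2 / P <= eta.
  rewrite -(@ler_pXn2r _ 3) ?nnegrE ?(ltW eta0) ?divr_ge0 ?(ltW P0) // -e3.
  by rewrite expr_div_n (le_trans _ hdelta) // -natrX.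
have PD : P <= D%:R ^+ b.
  by rewrite -powR_mulrn ?(ltW Dp) // ler_powR // ler1n ltnW.
have D4 : 16 <= D%:R ^+ 4 :> R by rewrite -natrX ler_nat -[16%N]/(2 ^ 4)%N leq_exp2r.
have PP : P ^+ 2 * 16 <= (D ^ (2 * b + 4))%N%:R.
  rewrite natrX exprD mulnC exprM ler_pM ?exprn_ge0 ?(ltW P0) //.
  by rewrite ler_pXn2r ?nnegrE ?exprn_ge0 ?(ltW P0) ?(ltW Dp).
apply: (@le_trans _ _ (P / (P ^+ 2 * 16))).
  rewrite ler_pM ?invr_ge0 // lef_pV2 ?posrE ?mulr_gt0 ?exprn_gt0 //.
  by rewrite (lt_le_trans _ PP) // mulr_gt0 ?exprn_gt0.
have -> : P / (P ^+ 2 * 16) = (2 / P) / 32 by field; rewrite gt_eqF.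
by lra.
Qed.

Local Open Scope classical_set_scope.
Local Open Scope ring_scope.

Theorem theorem1 (R : realType) (B : R) (hB : 0 < B) :
  exists c : R,
    forall (D : nat) (hD : (2 <= D)%N)
      (chi : int -> R[i]) (hchi : is_dirichlet_character D chi)
      (delta : R)
      (hdelta : 8 * (D%:R `^ (- (3 * B))) <= delta) (hdelta1 : delta <= 1)
      (t : R) (ht : `|t| <= D%:R `^ B)
      (x : R) (L : R)
      (hL : L = \sum_(p \in primes_between D x) (p%:R^-1 : R))
      (S : set nat) (hS : S `<=` primes_between D x)
      (hsum : \sum_(p \in S)
                (p%:R^-1 * (ComplexField.Normc.normc (1 - chi p%:Z * natpow_it p t)) ^+ 2)
              <= delta * L),
      \sum_(p \in S) (p%:R^-1 : R) <= 4 * (delta `^ (1 / 3)) * L + c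
      \/ exists r : nat,
           is_dchar_order D chi r /\ r%:R < 2 * (delta `^ (- (1 / 3))).
Proof.
pose b := (Num.truncn B).+1.
have Bb : B <= b%:R by rewrite ltW // truncnS_gt.
pose K : R := 2 * (2 * b + 10)%:R + (3 + 2 * ln 2) / ln 2.
(* The constants of [short_range_sum_le] and [near_one_sum_le], the latter with
   [eta] replaced by its upper bound [1]. *)
exists (K + 11 / 5 * harmonic_defect R + 5).
move=> D D2 chi hchi delta hdelta hdelta1 t ht x L hL S hS hsum.
have [] := cube_root_bounds D2 hB Bb hdelta ht.
set eta := delta `^ (1 / 3) => eta0 e3 -> tU.
have [r hr] := dchar_order_exists (ltnW D2) hchi.
case: (ltP r%:R (2 * eta^-1)) => [rlt|rge]; first by right; exists r.
left.
have eta1 : eta <= 1.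
  by rewrite -(@ler_pXn2r _ 3) ?nnegrE ?(ltW eta0) // -e3 expr1n.
have U16 : (16 <= D ^ (2 * b + 4))%N.
  by rewrite expnD -[16%N]/(1 * 2 ^ 4)%N leq_mul ?leq_exp2r // expn_gt0 ltnW.
set N := Num.truncn x.
have eL : L = \sum_(D.+1 <= p < N.+1 | prime p) (p%:R^-1 : R).
  rewrite hL (fsbig_primes_between _ (@subset_refl _ _)).
  rewrite [LHS]big_nat_cond [RHS]big_nat_cond; apply: eq_bigl => p.
  case: (boolP (D.+1 <= p < N.+1)%N) => //= h; case: (boolP (prime p)) => //= pp.
  exact/asboolP/primes_between_le_truncn.
have L0 : 0 <= L by rewrite eL sumr_ge0 // => p _; rewrite invr_ge0.
rewrite (fsbig_primes_between _ hS).
rewrite (fsbig_primes_between _ hS) in hsum.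
rewrite (bigID (near_one chi eta t)) /= addrC.
(* The hypothesis weighs each of these primes by at least [(15/16 eta)^2]. *)
have far : \sum_(D.+1 <= p < N.+1 | (prime p && `[< S p >]) && ~~ near_one chi eta t p)
     (p%:R^-1 : R) <= 256 / 225 * eta * L.
  have -> : 256 / 225 * eta * L = (15 / 16 * eta) ^- 2 * (delta * L).
    by rewrite e3; field; rewrite gt_eqF.
  apply: le_trans (ler_wpM2l _ hsum); last by rewrite invr_ge0 exprn_ge0 // mulr_ge0 // ltW.
  rewrite mulr_sumr [leLHS]big_mkcond [leRHS]big_mkcond; apply: ler_sum => p _.
  have p0 : 0 <= p%:R^-1 :> R by rewrite invr_ge0.
  have e0 : 0 < 15 / 16 * eta by rewrite mulr_gt0.
  case: ifP => [/andP[-> ]|_]; last first.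
    by case: ifP => // _; rewrite mulr_ge0 ?invr_ge0 ?sqr_ge0 // mulr_ge0 ?sqr_ge0.
  rewrite /near_one -ltNge => h; rewrite mulrCA ler_peMr // mulrC.
  rewrite ler_pdivlMr ?exprn_gt0 // mul1r.
  by rewrite ler_pXn2r ?nnegrE ?(ltW e0) ?(ltW h) // (le_trans (ltW e0)) // ltW.
have near : \sum_(D.+1 <= p < N.+1 | (prime p && `[< S p >]) && near_one chi eta t p)
     (p%:R^-1 : R) <= K + eta * (11 / 5 * (L + harmonic_defect R) + 5).
  have := near_one_sum_le D2 hchi hr rge eta0 eta1 U16 tU N; rewrite -eL.
  have := short_range_sum_le R b D2; rewrite -/K => h1 h2.
  apply: le_trans (le_trans h2 _); last by rewrite lerD2r.
  by apply: ler_sum_nat_cond => // p /andP[/andP[-> _] ->].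
apply: (le_trans (lerD far near)).
have lp : 0 < ln 2 :> R by rewrite ln_gt0 // ltr1n.
have H0 : 0 <= 11 / 5 * harmonic_defect R + 5.
  by rewrite addr_ge0 // mulr_ge0 // addr_ge0 // divr_ge0 ?addr_ge0 ?mulr_ge0 ?(ltW lp).
have h1 : eta * (11 / 5 * harmonic_defect R + 5) <= 11 / 5 * harmonic_defect R + 5.
  by rewrite ler_piMl.
have h2 : 0 <= eta * L by rewrite mulr_ge0 // ltW.
rewrite !mulrDr in h1 *; rewrite -!mulrA; move: h1 h2; lra.
Qed.
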